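(* Let $\lambda\in\mathbb{C}$ be generic (i.e. outside a suitable finite set), let $C_\lambda\subset\mathbb{P}^2$ be the sextic curve dual to the cubic $E_\lambda: x^3+y^3+z^3-3\lambda xyz=0$, let $\mathcal{P}_9$ be the set of the nine cusps of $C_\lambda$, and let $\mathcal{C}_{12}$ be the set of conics in $\mathbb{P}^2$ that contain at least $6$ points of $\mathcal{P}_9$. Then $\mathcal{C}_{12}$ has cardinality $12$. Each conic in $\mathcal{C}_{12}$ contains exactly $6$ points of $\mathcal{P}_9$, and through each point of $\mathcal{P}_9$ there pass exactly $8$ conics of $\mathcal{C}_{12}$. Hence the sets $(\mathcal{P}_9,\mathcal{C}_{12})$ form a $(9_8,12_6)$-configuration.
   Context: We work over $\mathbb{C}$; $\omega$ satisfies $\omega^2+\omega+1=0$. For generic $\lambda$ the dual curve $C_\lambda$ of the smooth cubic $E_\lambda$ is a sextic with exactly nine singular points, all ordinary cusps, corresponding to the nine inflection points of $E_\lambda$. Explicitly, the cusps are $p_1=(\lambda:1:1)$, $p_2=(1:\lambda:1)$, $p_3=(1:1:\lambda)$, $p_4=(\lambda:\omega:\omega^2)$, $p_5=(\omega^2:\lambda:\omega)$, $p_6=(\omega:\omega^2:\lambda)$, $p_7=(\lambda:\omega^2:\omega)$, $p_8=(\omega:\lambda:\omega^2)$, $p_9=(\omega^2:\omega:\lambda)$. A $(v_r,b_k)$-configuration consists of two sets $\mathcal{P}$, $\mathcal{L}$ of cardinalities $v$ and $b$ and an incidence relation $I\subset\mathcal{P}\times\mathcal{L}$ such that each element of $\mathcal{P}$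 is incident to exactly $r$ elements of $\mathcal{L}$ and each element of $\mathcal{L}$ is incident to exactly $k$ elements of $\mathcal{P}$. Here incidence means that the point lies on the conic. *)

(* Defs.v *)
From HB Require Import structures.
From mathcomp Require Import all_boot all_order all_algebra.
From mathcomp Require Import complex.
From mathcomp Require Import mpoly.
From mathcomp Require Import classical_sets functions cardinality reals.

Set Implicit Arguments.
Unset Strict Implicit.
Unset Printing Implicit Defensive.

Import GRing.Theory.
Local Open Scope ring_scope.
Local Open Scope classical_set_scope.
Local Open Scope card_scope.

(* The projective plane over K, as the set of lines through 0 in K^3. The dual
   plane is identified with it by letting (a : b : c) stand for the line
   a x + b y + c z = 0. *)
Definition proj_plane (K : fieldType) :=
  {p : {vspace 'rV[K]_3} | \dim p == 1%N}.

Definition vanishes_at (K : fieldType) (F : {mpoly K[3]}) (p : proj_plane K) :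
  Prop :=
  forall v : 'rV[K]_3, v \in val p -> F.@[v 0] = 0.

Definition zero_locus (K : fieldType) (F : {mpoly K[3]}) : set (proj_plane K) :=
  [set p | vanishes_at F p].

(* F is the reduced equation of the plane curve Z: it generates the ideal of
   the polynomials vanishing on the cone over Z. *)
Definition equation_of (K : fieldType) (F : {mpoly K[3]})
  (Z : set (proj_plane K)) : Prop :=
  forall G : {mpoly K[3]},
    (forall p, Z p -> vanishes_at G p) <-> exists H : {mpoly K[3]}, G = H * F.

Definition gradient (K : fieldType) (F : {mpoly K[3]}) (v : 'rV[K]_3) :
  'rV[K]_3 :=
  \row_(i < 3) (mderiv i F).@[v 0].

(* The set of the tangent lines of the curve F = 0 at its smooth points. When
   that curve is smooth, this set is already closed. *)
Definition dual_curve (K : fieldType) (F : {mpoly K[3]}) : set (proj_plane K) :=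
  [set l | exists v : 'rV[K]_3,
     [/\ v != 0, F.@[v 0] = 0, gradient F v != 0
       & val l = <[gradient F v]>%VS]].

(* The equation, in the affine chart (s, t) |-> b_0 + s b_1 + t b_2, of the
   curve F = 0, where b_0, b_1, b_2 are the rows of B. *)
Definition local_equation (K : fieldType) (F : {mpoly K[3]}) (B : 'M[K]_3) :
  {mpoly K[2]} :=
  F \mPo [tuple (B 0 i)%:MP + B 1 i *: 'X_0 + B ord_max i *: 'X_1 | i < 3].

(* The curve F = 0 has an ordinary cusp (A_2 singularity) at p: p is a double
   point with a single tangent, which meets the curve at p with multiplicity 3.
   In suitable affine coordinates (s, t) centred at p, the 2-jet of the
   equation is c s^2 with c != 0, and the coefficient of t^3 is not 0. *)
Definition ordinary_cusp (K : fieldType) (F : {mpoly K[3]}) (p : proj_plane K) :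
  Prop :=
  exists B : 'M[K]_3,
    let g := local_equation F B in
    [/\ B \in unitmx,
        val p = <[row 0%R B]>%VS,
        forall m : 'X_{1..2}, (mdeg m <= 2)%N ->
          (g@_m != 0) = (m == (U_(0%R) *+ 2)%MM)
      & g@_(U_(1%R) *+ 3)%MM != 0].

Definition cusps (K : fieldType) (Z : set (proj_plane K)) :
  set (proj_plane K) :=
  [set p | exists2 F, equation_of F Z & ordinary_cusp F p].

(* Reducible conics and double lines are allowed. Over an algebraically closed
   field, the zero locus determines the quadratic form up to a scalar. *)
Definition conic (K : fieldType) (Z : set (proj_plane K)) : Prop :=
  exists Q : {mpoly K[3]}, [/\ Q != 0, Q \is 2.-homog & Z = zero_locus Q].

Definition conics_through_at_least (K : fieldType) (n : nat)
  (P : set (proj_plane K)) : set (set (proj_plane K)) :=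
  [set Z | conic Z /\ `I_n #<= Z `&` P].

Definition configuration (T U : Type) (P : set T) (L : set U)
  (I : T -> U -> Prop) (v r b k : nat) : Prop :=
  [/\ P #= `I_v, L #= `I_b,
      forall p, P p -> [set l | L l /\ I p l] #= `I_r
    & forall l, L l -> [set p | P p /\ I p l] #= `I_k].

Definition hesse_cubic (K : fieldType) (lambda : K) : {mpoly K[3]} :=
  \sum_(i < 3) 'X_i ^+ 3 - (3%:R * lambda) *: \prod_(i < 3) 'X_i.

(* Main.v *)
Require Import Defs.
From HB Require Import structures.
From mathcomp Require Import all_boot all_order all_algebra.
From mathcomp Require Import separable.
From mathcomp Require Import ring zify.
From mathcomp Require Import complex.
From mathcomp Require Import mpoly.
From mathcomp Require Import classical_sets functions cardinality reals.

(* Write l for lambda.  The dual sextic F is the discriminant of the restriction of the cubic f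
   to a line, so its zeros are exactly the tangent lines of f.  Modulo f, each partial derivative
   of F at the gradient of f in (x, y, z) is a multiple of (l^3 - 1)^3 (x y z)^3: hence F is
   singular only at the images of the nine flexes, and on a general line through (0 : 0 : 1) it
   has six distinct zeros, which forces every polynomial vanishing on the dual curve to be a
   multiple of F.

   For the conics, write the quadratic form as the sum of A_r X_r^2 + B_r X_(r+1) X_(r-1), and
   put D_r = A_r l^2 + B_r and E_r = A_r + l B_r; this change of coordinates is invertible
   because l^3 <> 1.  At the cusp obtained from (l : u : u^2), u^3 = 1, by r cyclic shifts, the
   form takes the value D_r + E_(r-1) u + E_(r+1) u^2.  So the question is which triples of
   polynomials in u of this shape have six zeros among the nine pairs (r, u), independently of
   l; the zeros turn out to be the complements of the twelve lines of the affine plane over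
   F_3. *)

Set Implicit Arguments.
Unset Strict Implicit.
Unset Printing Implicit Defensive.

Import GRing.Theory Num.Theory.
Local Open Scope ring_scope.

(** * The Hesse cubic and its dual sextic *)

(** Stated over any commutative ring, so that the same identities serve for scalars and for
    polynomials. *)
Definition hesse (A : comNzRingType) (l x y z : A) : A :=
  x ^+ 3 + y ^+ 3 + z ^+ 3 - 3%:R * l * (x * y * z).

Definition sextic (A : comNzRingType) (l a b c : A) : A :=
  a ^+ 6 + b ^+ 6 + c ^+ 6
  - (2%:R - 4%:R * l ^+ 3)
    * (a ^+ 3 * b ^+ 3 + b ^+ 3 * c ^+ 3 + c ^+ 3 * a ^+ 3)
  - 6%:R * l ^+ 2 * (a * b * c) * (a ^+ 3 + b ^+ 3 + c ^+ 3)
  - (3%:R * l ^+ 4 - 12%:R * l) * (a * b * c) ^+ 2.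

(* The partial derivative of [sextic l a b c] with respect to [a]. *)
Definition dsextic (A : comNzRingType) (l a b c : A) : A :=
  6%:R * a ^+ 5
  - (2%:R - 4%:R * l ^+ 3) * (3%:R * a ^+ 2 * (b ^+ 3 + c ^+ 3))
  - 6%:R * l ^+ 2 * (b * c) * (4%:R * a ^+ 3 + b ^+ 3 + c ^+ 3)
  - (3%:R * l ^+ 4 - 12%:R * l) * (2%:R * a * (b * c) ^+ 2).

Lemma hesse_cyc (A : comNzRingType) (l x y z : A) : hesse l y z x = hesse l x y z.
Proof. rewrite /hesse; ring. Qed.

Lemma sextic_cyc (A : comNzRingType) (l x y z : A) : sextic l y z x = sextic l x y z.
Proof. rewrite /sextic; ring. Qed.

Lemma sextic_gradient (A : comNzRingType) (l x y z : A) : hesse l x y z = 0 ->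
  sextic l (x ^+ 2 - l * (y * z)) (y ^+ 2 - l * (z * x)) (z ^+ 2 - l * (x * y)) = 0.
Proof.
(* Solved for x^3, the cubic relation is a rewriting rule with which [ring] decides the identity
   modulo f. *)
move=> h. have h' : x ^+ 3 = 3%:R * l * (x * y * z) - y ^+ 3 - z ^+ 3.
  by apply/eqP; rewrite -subr_eq0 -h /hesse; apply/eqP; ring.
rewrite /sextic; ring: h'.
Qed.

(** Biduality: the gradient of F at a tangent line is proportional to the point of tangency. The
    factor (x y z)^3 accounts for the flexes, the points of the cubic on the triangle x y z = 0. *)
Lemma dsextic_gradient (A : comNzRingType) (l x y z : A) : hesse l x y z = 0 ->
  dsextic l (x ^+ 2 - l * (y * z)) (y ^+ 2 - l * (z * x)) (z ^+ 2 - l * (x * y))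
  = - 12%:R * (l ^+ 3 - 1) ^+ 3 * x * (x * y * z) ^+ 3.
Proof.
move=> h. have h' : x ^+ 3 = 3%:R * l * (x * y * z) - y ^+ 3 - z ^+ 3.
  by apply/eqP; rewrite -subr_eq0 -h /hesse; apply/eqP; ring.
rewrite /dsextic; ring: h'.
Qed.

(** * Tangent lines, flexes and singular points of the sextic *)

Section Tangents.
Variable K : numFieldType.
Implicit Types a b c d l x y z : K.

Lemma hesse_smooth l x y z : l ^+ 3 != 1 ->
  x ^+ 2 = l * (y * z) -> y ^+ 2 = l * (z * x) -> z ^+ 2 = l * (x * y) ->
  [/\ x = 0, y = 0 & z = 0].
Proof.
move=> l3 hx hy hz.
have [xyz0|] := eqVneq (x * y * z) 0; last first.
  (* Multiplying the three relations gives (l^3 - 1) (x y z)^2 = 0. *)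
  move=> nz; case/negP: l3; rewrite -subr_eq0.
  rewrite -(mulIr_eq0 _ (mulIf (expf_neq0 2 nz))) mulrBl mul1r.
  apply/eqP.
  transitivity (l * (y * z) * (l * (z * x)) * (l * (x * y)) - (x * y * z) ^+ 2).
    by ring.
  by rewrite -hx -hy -hz; ring.
have sq0 (t : K) : t ^+ 2 = 0 -> t = 0 by move/eqP; rewrite expf_eq0 => /eqP.
have [x0 | y0 | z0] : [\/ x = 0, y = 0 | z = 0].
- move/eqP: xyz0; rewrite !mulf_eq0 -orbA.
  by case/or3P=> /eqP ->; [constructor 1 | constructor 2 | constructor 3].
- by rewrite x0 ?(mul0r, mulr0) in hy hz; split; rewrite ?x0 //; apply: sq0.
- by rewrite y0 ?(mul0r, mulr0) in hx hz; split; rewrite ?y0 //; apply: sq0.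
- by rewrite z0 ?(mul0r, mulr0) in hx hy; split; rewrite ?z0 //; apply: sq0.
Qed.

(* The double root of a binary cubic is the root of its Hessian form. *)
Lemma cubic_double_root a b c d :
  (b * c - 9%:R * a * d) ^+ 2
    = 4%:R * (b ^+ 2 - 3%:R * a * c) * (c ^+ 2 - 3%:R * b * d) ->
  exists x y, [/\ (x != 0) || (y != 0),
    3%:R * a * x ^+ 2 + 2%:R * b * x * y + c * y ^+ 2 = 0
    & b * x ^+ 2 + 2%:R * c * x * y + 3%:R * d * y ^+ 2 = 0].
Proof.
set P := b ^+ 2 - _; set Q := b * c - _; set R := c ^+ 2 - _ => hQ.
have n2 : (2%:R : K) != 0 by rewrite pnatr_eq0.
have n3 : (3%:R : K) != 0 by rewrite pnatr_eq0.
have [P0 | P0] := eqVneq P 0; last first.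
  (* The Hessian form is P x^2 + Q x y + R y^2; its discriminant vanishes, so (- Q : 2 P) is its
     double root. *)
  exists (- Q), (2%:R * P); split; first by rewrite orbC mulf_neq0.
    transitivity (3%:R * a * Q ^+ 2 - 4%:R * b * P * Q + 4%:R * c * P ^+ 2); first by ring.
    by rewrite hQ /P /Q /R; ring.
  transitivity (b * Q ^+ 2 - 4%:R * c * P * Q + 12%:R * d * P ^+ 2); first by ring.
  by rewrite hQ /P /Q /R; ring.
have Q0 : Q = 0.
  by apply/eqP; rewrite -sqrf_eq0 hQ P0 mulr0 mul0r.
have b2 : b ^+ 2 = 3%:R * a * c by apply/eqP; rewrite -subr_eq0 -/P P0.
have bc : b * c = 9%:R * a * d by apply/eqP; rewrite -subr_eq0 -/Q Q0.
have [a0 | a0] := eqVneq a 0.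
  have b0 : b = 0 by apply/eqP; rewrite -sqrf_eq0 b2 a0 mulr0 mul0r.
  by exists 1, 0; split; rewrite ?oner_eq0 // ?a0 b0; ring.
have R0 : R = 0.
  apply/eqP; rewrite -(mulrI_eq0 _ (mulfI (mulf_neq0 n3 a0))); apply/eqP.
  transitivity (3%:R * a * c * c - b * (9%:R * a * d)); first by rewrite /R; ring.
  by rewrite -b2 -bc; ring.
have c2 : c ^+ 2 = 3%:R * b * d by apply/eqP; rewrite -subr_eq0 -/R R0.
(* The whole Hessian vanishes, so the cubic is a cube up to a scalar, with triple root (- b : 3
   a). *)
exists (- b), (3%:R * a); split; first by rewrite orbC mulf_neq0.
  transitivity (3%:R * a * (3%:R * a * c - b ^+ 2)); first by ring.
  by rewrite b2 subrr mulr0.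
transitivity (b * (b ^+ 2) - 6%:R * a * (b * c) + 27%:R * a ^+ 2 * d); first by ring.
rewrite b2.
transitivity (3%:R * a * (b * c) - 6%:R * a * (b * c) + 27%:R * a ^+ 2 * d); first by ring.
by rewrite bc; ring.
Qed.

Definition on_dual l a b c := exists x y z k,
  [/\ hesse l x y z = 0, [|| x != 0, y != 0 | z != 0], k != 0 &
   [/\ a = k * (x ^+ 2 - l * (y * z)), b = k * (y ^+ 2 - l * (z * x))
     & c = k * (z ^+ 2 - l * (x * y))]].

Lemma on_dual_cyc l a b c : on_dual l a b c -> on_dual l b c a.
Proof.
move=> [x [y [z [k [h nz k0 [ha hb hc]]]]]]; exists y, z, x, k; split=> //.
by rewrite hesse_cyc.
by case/or3P: nz => ->; rewrite ?orbT.
Qed.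

(** Where c != 0, eliminating z restricts f to the line as a binary cubic whose discriminant is F up
    to a nonzero factor; its double root is the point of tangency. Cyclic symmetry gives the other
    charts. *)
Lemma sextic_on_dual l a b c : l ^+ 3 != 1 -> sextic l a b c = 0 ->
  [|| a != 0, b != 0 | c != 0] -> on_dual l a b c.
Proof.
move=> l3; have main a' b' c' : sextic l a' b' c' = 0 -> c' != 0 -> on_dual l a' b' c'.
  move: a' b' c' => {}a {}b {}c h c0.
  (* A, B, C, D are the coefficients of c^3 f(x, y, - (a x + b y) / c). *)
  pose A := c ^+ 3 - a ^+ 3; pose D := c ^+ 3 - b ^+ 3.
  pose B := - 3%:R * a ^+ 2 * b + 3%:R * l * c ^+ 2 * a.
  pose C := - 3%:R * a * b ^+ 2 + 3%:R * l * c ^+ 2 * b.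
  have [] := @cubic_double_root A B C D.
    apply/eqP; rewrite -subr_eq0; apply/eqP.
    transitivity (81%:R * c ^+ 6 * sextic l a b c); last by rewrite h mulr0.
    by rewrite /A /B /C /D /sextic; ring.
  move=> x [y [nz hx hy]]; pose z := - (a * x + b * y) / c.
  pose gx := x ^+ 2 - l * (y * z); pose gy := y ^+ 2 - l * (z * x).
  pose gz := z ^+ 2 - l * (x * y).
  have n3 : (3%:R : K) != 0 by rewrite pnatr_eq0.
  (* At a double root both partial derivatives of the restricted cubic vanish: the gradient of f is
     parallel to (a, b, c). *)
  have ex : c * gx = a * gz.
    apply/eqP; rewrite -subr_eq0 -(mulrI_eq0 _ (mulfI (mulf_neq0 n3 (expf_neq0 2 c0)))) -hx.
    by apply/eqP; rewrite /gx /gz /z /A /B /C; field.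
  have ey : c * gy = b * gz.
    apply/eqP; rewrite -subr_eq0 -(mulrI_eq0 _ (mulfI (mulf_neq0 n3 (expf_neq0 2 c0)))) -hy.
    by apply/eqP; rewrite /gy /gz /z /B /C /D; field.
  have gz0 : gz != 0.
    apply/eqP => gz0; move/eqP: ex; move/eqP: ey; rewrite gz0 !mulr0 !mulf_eq0 (negPf c0) /=.
    rewrite /gx /gy !subr_eq0 => /eqP sy /eqP sx.
    have [] := hesse_smooth l3 sx sy; first by apply/eqP; rewrite -subr_eq0 -/gz gz0.
    by move=> x0 y0 _; rewrite x0 y0 eqxx in nz.
  exists x, y, z, (c / gz); split.
  (* By Euler's relation, f vanishes at (x, y, z) because this point lies on the line. *)
  - have : 3%:R * c * hesse l x y z = 3%:R * (x * (c * gx) + y * (c * gy) + z * c * gz).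
      by rewrite /hesse /gx /gy /gz; ring.
    rewrite ex ey; have -> : x * (a * gz) + y * (b * gz) + z * c * gz = 0.
      by rewrite /z; field.
    by move/eqP; rewrite mulr0 mulf_eq0 (negPf (mulf_neq0 n3 c0)) => /eqP.
  - by case/orP: nz => ->; rewrite ?orbT.
  - by rewrite mulf_neq0 ?invr_eq0.
  - by rewrite -/gx -/gy -/gz; split; rewrite mulrAC ?ex ?ey mulfK.
move=> h /or3P[a0 | b0 | c0]; last exact: main.
- by apply/on_dual_cyc/on_dual_cyc/main => //; rewrite -sextic_cyc -sextic_cyc.
- by apply/on_dual_cyc/main => //; rewrite -sextic_cyc.
Qed.


Definition cusp_coord l (r : 'I_3) u : K * K * K :=
  match val r with
  | 0%N => (l, u, u ^+ 2)
  | 1%N => (u ^+ 2, l, u)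
  | _ => (u, u ^+ 2, l)
  end.

Lemma cube_neq0 (u : K) : u ^+ 3 = 1 -> u != 0.
Proof. by move=> h; apply/eqP => u0; move/eqP: h; rewrite u0 expr0n eq_sym oner_eq0. Qed.

(** If x = 0 then y^3 + z^3 = 0, so u = - y / z is a cube root of unity and the gradient (- l y z,
    y^2, z^2) equals - y z (l, u, u^2). The other two cases are cyclic shifts. *)
Lemma flex_cusp l x y z : hesse l x y z = 0 -> [|| x != 0, y != 0 | z != 0] ->
  x * y * z = 0 ->
  exists r u m, [/\ u ^+ 3 = 1, m != 0 &
   (x ^+ 2 - l * (y * z), y ^+ 2 - l * (z * x), z ^+ 2 - l * (x * y))
   = (m * (cusp_coord l r u).1.1, m * (cusp_coord l r u).1.2, m * (cusp_coord l r u).2)].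
Proof.
have main y' z' : y' ^+ 3 + z' ^+ 3 = 0 -> (y' != 0) || (z' != 0) ->
    exists u m, [/\ u ^+ 3 = 1, m != 0 &
     [/\ - (l * (y' * z')) = m * l, y' ^+ 2 = m * u & z' ^+ 2 = m * u ^+ 2]].
  move: y' z' => {}y {}z h nz.
  have hz : z ^+ 3 = - y ^+ 3 by apply/eqP; rewrite -addr_eq0 addrC h.
  have y0 : y != 0.
    apply/eqP => y0; move/eqP: hz; rewrite y0 expr0n oppr0 expf_eq0 /= => z0.
    by rewrite y0 eqxx z0 in nz.
  have z0 : z != 0 by have := expf_neq0 3 y0; rewrite -oppr_eq0 -hz expf_eq0.
  exists (- (y / z)), (- (y * z)); split; first by rewrite exprNn expr_div_n hz; field.
    by rewrite oppr_eq0 mulf_neq0.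
  split; first by ring.
    by field.
  have -> : - (y * z) * (- (y / z)) ^+ 2 = - y ^+ 3 / z by field.
  by rewrite -hz; field.
move=> h nz /eqP; rewrite !mulf_eq0 -orbA => /or3P[] /eqP e0.
- have [||u [m [u3 m0 [e1 e2 e3]]]] := main y z.
  + by rewrite -[RHS]h /hesse e0; ring.
  + by rewrite e0 eqxx in nz.
  by exists 0, u, m; split=> //; rewrite -e1 -e2 -e3 e0 !(expr0n, mulr0, mul0r, subr0, sub0r).
- have [||u [m [u3 m0 [e1 e2 e3]]]] := main z x.
  + by rewrite -[RHS]h /hesse e0; ring.
  + by rewrite e0 eqxx /= orbC in nz.
  by exists 1, u, m; split=> //; rewrite -e1 -e2 -e3 e0 !(expr0n, mulr0, mul0r, subr0, sub0r).
- have [||u [m [u3 m0 [e1 e2 e3]]]] := main x y.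
  + by rewrite -[RHS]h /hesse e0; ring.
  + by rewrite e0 eqxx /= orbF in nz.
  by exists ord_max, u, m; split=> //; rewrite -e1 -e2 -e3 e0 !(expr0n, mulr0, mul0r, subr0, sub0r).
Qed.

Definition is_cusp_multiple l a b c := exists r u m, [/\ u ^+ 3 = 1, m != 0 &
   (a, b, c) = (m * (cusp_coord l r u).1.1, m * (cusp_coord l r u).1.2,
     m * (cusp_coord l r u).2)].

Lemma on_dual_xyz l a b c : on_dual l a b c ->
  is_cusp_multiple l a b c \/
  exists x y z k, [/\ hesse l x y z = 0, x * y * z != 0, k != 0 &
   [/\ a = k * (x ^+ 2 - l * (y * z)), b = k * (y ^+ 2 - l * (z * x))
     & c = k * (z ^+ 2 - l * (x * y))]].
Proof.
move=> [x [y [z [k [h nz k0 [ea eb ec]]]]]].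
have [xyz0|] := eqVneq (x * y * z) 0; last by right; exists x, y, z, k.
left; have [r [u [m [u3 m0 [e1 e2 e3]]]]] := flex_cusp h nz xyz0.
exists r, u, (k * m); split; rewrite ?mulf_neq0 //.
by rewrite ea eb ec e1 e2 e3 !mulrA.
Qed.

Lemma dsextic_on_dual l x y z (k : K) : l ^+ 3 != 1 -> hesse l x y z = 0 -> k != 0 ->
  x * y * z != 0 ->
  dsextic l (k * (x ^+ 2 - l * (y * z))) (k * (y ^+ 2 - l * (z * x)))
     (k * (z ^+ 2 - l * (x * y))) != 0.
Proof.
move=> l3 h k0 nz.
have hom a b c : dsextic l (k * a) (k * b) (k * c) = k ^+ 5 * dsextic l a b c.
  by rewrite /dsextic; ring.
rewrite hom dsextic_gradient // mulf_neq0 ?expf_neq0 // mulf_neq0 ?expf_neq0 //.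
rewrite mulf_neq0 ?mulf_neq0 ?expf_neq0 ?oppr_eq0 ?pnatr_eq0 ?subr_eq0 //.
by apply: contraNneq nz => ->; rewrite ?(mul0r, mulr0).
Qed.

(** Away from the flexes x is nonzero, so a single partial derivative already detects the singular
    points. *)
Lemma sextic_singular l a b c : l ^+ 3 != 1 -> sextic l a b c = 0 ->
  [|| a != 0, b != 0 | c != 0] -> dsextic l a b c = 0 -> is_cusp_multiple l a b c.
Proof.
move=> l3 h nz d; have [//|] := on_dual_xyz (sextic_on_dual l3 h nz).
move=> [x [y [z [k [hxyz xyz0 k0 [ea eb ec]]]]]].
by have := dsextic_on_dual l3 hxyz k0 xyz0; rewrite -ea -eb -ec d eqxx.
Qed.

(** A multiple root in c would be a singular point, hence a cusp. The three factors of the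
    hypothesis vanish on the cusps having l in third, first and second place among (a, b, c). *)
Lemma sextic_simple_roots l a b c : l ^+ 3 != 1 ->
  (a ^+ 3 - b ^+ 3) * (a ^+ 3 - l ^+ 3 * b ^+ 3) * (b ^+ 3 - l ^+ 3 * a ^+ 3) != 0 ->
  sextic l a b c = 0 -> dsextic l c a b != 0.
Proof.
move=> l3 nz h; apply/negP => /eqP d.
have [||//|r [u [m [u3 m0 [ec ea eb]]]]] := @sextic_singular l c a b l3.
- by rewrite -sextic_cyc.
- apply: contraNT nz; rewrite !negb_or !negbK => /and3P[_ /eqP-> /eqP->].
  by rewrite subrr !mul0r.
case/negP: nz; rewrite ea eb; case: r {ec ea eb} => -[|[|[|//]]] lt3 /=; rewrite /cusp_coord /=.
- have -> : (m * u) ^+ 3 - (m * u ^+ 2) ^+ 3 = m ^+ 3 * u ^+ 3 * (1 - u ^+ 3) by ring.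
  by rewrite u3 subrr mulr0 !mul0r.
- have -> : (m * l) ^+ 3 - l ^+ 3 * (m * u) ^+ 3 = m ^+ 3 * l ^+ 3 * (1 - u ^+ 3) by ring.
  by rewrite u3 subrr mulr0 mulr0 mul0r.
- have -> : (m * l) ^+ 3 - l ^+ 3 * (m * u ^+ 2) ^+ 3
    = m ^+ 3 * l ^+ 3 * (1 - u ^+ 3 * u ^+ 3) by ring.
  by rewrite u3 mulr1 subrr !mulr0.
Qed.
End Tangents.

(** * Triples of quadratic polynomials at the cube roots of unity *)

(* With w a primitive cube root of unity, (r, k) stands for the r-th cyclic shift of the
   cusp (l : w^k : w^2k), [inl s] for the conic through the cusps (r, k) with r != s, and
   [inr (i, j)] for the one that misses the cusps (0, i), (1, j) and (2, - (i + j)). *)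
Notation conic_index := ('I_3 + 'I_3 * 'I_3)%type.

(** Values i, j, k at 0, 1, 2 are those of an affine function on F_3 exactly when i + j + k = 0; so
    these triples are the lines that meet every row once. *)
Definition missed (i j r : 'I_3) : 'I_3 :=
  match val r with 0%N => i | 1%N => j | _ => - (i + j) end.

Definition passes (L : conic_index) (p : 'I_3 * 'I_3) : bool :=
  match L with
  | inl s => p.1 != s
  | inr ij => p.2 != missed ij.1 ij.2 p.1
  end.

(** Explicit lists make the incidence counts a matter of computation. *)
Definition trits : seq 'I_3 := [:: 0; 1; ord_max].
Definition cusp_indices : seq ('I_3 * 'I_3) := [seq (r, k) | r <- trits, k <- trits].
Definition conic_indices : seq conic_index :=
  [seq inl s | s <- trits] ++ [seq inr ij | ij <- cusp_indices].

Lemma tritP (P : 'I_3 -> Prop) : P 0 -> P 1 -> P ord_max -> forall r, P r.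
Proof.
by move=> P0 P1 P2 [[|[|[|//]]] h]; [move: P0 | move: P1 | move: P2];
  congr P; apply: val_inj.
Qed.

Lemma count_passes_conic L : count (passes L) cusp_indices = 6%N.
Proof. by case: L => [s | [i j]]; [move: s | move: i j]; do ?elim/tritP. Qed.

Lemma count_passes_cusp p : count (passes^~ p) conic_indices = 8%N.
Proof. by case: p; elim/tritP; elim/tritP. Qed.

Lemma mem_cusp_indices p : p \in cusp_indices.
Proof. by case: p; elim/tritP; elim/tritP. Qed.

Lemma mem_conic_indices L : L \in conic_indices.
Proof. by case: L => [|[]]; do ?elim/tritP. Qed.

Lemma passes_inj L L' : passes L =1 passes L' -> L = L'.
Proof.
have shift (a : 'I_3) : (a + 1 == a) = false by rewrite -subr_eq0 addrAC subrr.
case: L => [s | [i j]]; case: L' => [s' | [i' j']] h.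
- by have := h (s, 0); rewrite /= eqxx /= => /esym/negbFE/eqP ->.
(* The shifted index is a cusp of row s that the second conic contains and the first misses. *)
- by have := h (s, missed i' j' s + 1); rewrite /= eqxx shift.
- by have := h (s', missed i j s' + 1); rewrite /= eqxx shift.
have := h (0, i); have := h (1, j).
by rewrite /= !eqxx => /esym/negbFE/eqP -> /esym/negbFE/eqP ->.
Qed.

(** * Forms with six zeros at the cusps *)

Section Sextuples.
Variables (K : numFieldType) (w : K).
Hypothesis w_root : w ^+ 2 + w + 1 = 0.
Implicit Types (D E : 'I_3 -> K).

Lemma w_cube : w ^+ 3 = 1.
Proof.
apply/eqP; rewrite -subr_eq0.
have -> : w ^+ 3 - 1 = (w - 1) * (w ^+ 2 + w + 1) by ring.
by rewrite w_root mulr0.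
Qed.

Lemma w_exp_cube n : (w ^+ n) ^+ 3 = 1.
Proof. by rewrite -exprM mulnC exprM w_cube expr1n. Qed.

Lemma w_neq1 : w != 1.
Proof.
apply/eqP => w1; move: w_root; rewrite w1 expr1n => /eqP.
have -> : 1 + 1 + 1 = 3%:R :> K by ring.
by rewrite pnatr_eq0.
Qed.

Lemma w_exp_inj (i j : 'I_3) : (w ^+ i == w ^+ j) = (i == j).
Proof.
have w0 := cube_neq0 w_cube; have w1 := w_neq1.
have w2 : w ^+ 2 != 1.
  by apply: contraNneq w1 => h; rewrite -w_cube exprS h mulr1.
have w12 : w ^+ 2 != w.
  by apply: contraNneq w1 => h; apply/eqP/(mulfI w0); rewrite mulr1 -expr2 h.
move: i j; elim/tritP; elim/tritP; rewrite /= ?eqxx ?expr0 ?expr1 //;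
  by rewrite ?[1 == _]eq_sym ?(negPf w1) ?(negPf w2) // ?[w == _]eq_sym ?(negPf w12).
Qed.

Lemma missed_prod i j :
  w ^+ missed i j 0 * w ^+ missed i j 1 * w ^+ missed i j ord_max = 1.
Proof.
have w3 := w_cube; have w6 := w_exp_cube 2; rewrite -exprM in w6.
by rewrite -!exprD; move: i j; elim/tritP; elim/tritP.
Qed.

Definition row_value D E (r : 'I_3) (u : K) := D r + E (r - 1) * u + E (r + 1) * u ^+ 2.

(** For [inl s] only the constant term of row s survives. For [inr (i, j)], row r must be
    proportional to u^2 + u v + v^2 in v, where u is the missed root; this gives E (r - 1) = E (r +
    1) u and D r = E (r + 1) u^2. Starting from E 1 = 1, the recursion closes up because the three
    missed roots have product 1. *)
Definition conic_E (L : conic_index) (r : 'I_3) : K :=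
  match L with
  | inl s => 0
  | inr (i, j) => match val r with 0%N => w ^+ i * w ^+ j | 1%N => 1 | _ => w ^+ i end
  end.

Definition conic_D (L : conic_index) (r : 'I_3) : K :=
  match L with
  | inl s => (r == s)%:R
  | inr (i, j) => conic_E L (r + 1) * (w ^+ missed i j r) ^+ 2
  end.

Lemma ord3E :
  ((0 - 1 = ord_max :> 'I_3)%R * (0 + 1 = 1 :> 'I_3)%R * (1 - 1 = 0 :> 'I_3)%R
  * (1 + 1 = ord_max :> 'I_3)%R * (ord_max - 1 = 1 :> 'I_3)%R
  * (ord_max + 1 = 0 :> 'I_3)%R)%type.
Proof. by do !split; apply: val_inj. Qed.

Lemma conic_E_step i j (r : 'I_3) (L := inr (i, j)) :
  conic_E L (r - 1) = conic_E L (r + 1) * w ^+ missed i j r.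
Proof.
by move: r; elim/tritP; rewrite !ord3E /= ?mul1r // -(missed_prod i j).
Qed.

Lemma conic_E_neq0 i j r : conic_E (inr (i, j)) r != 0.
Proof.
have w0 := cube_neq0 w_cube.
by move: r; elim/tritP; rewrite /= ?mulf_neq0 ?expf_neq0 ?oner_eq0.
Qed.

(** Since (v - u) (u^2 + u v + v^2) = v^3 - u^3, the factor vanishes at each cube root of unity v !=
    u, while at v = u it is 3 u^2. *)
Lemma conic_zeros L r (k : 'I_3) :
  (row_value (conic_D L) (conic_E L) r (w ^+ k) == 0) = passes L (r, k).
Proof.
case: L => [s | [i j]]; rewrite /row_value.
  by rewrite /= !mul0r !addr0; case: (r == s); rewrite ?oner_eq0 ?eqxx.
rewrite conic_E_step [conic_D _ _]/=; set e := conic_E _ _; set u := w ^+ missed i j r.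
have -> : e * u ^+ 2 + e * u * w ^+ k + e * (w ^+ k) ^+ 2
  = e * (u ^+ 2 + u * w ^+ k + (w ^+ k) ^+ 2) by ring.
rewrite mulf_eq0 (negPf (conic_E_neq0 _ _ _)) /= -w_exp_inj -/u.
set v := w ^+ k; have [-> | vu] := eqVneq v u.
  have -> : u ^+ 2 + u * u + u ^+ 2 = 3%:R * u ^+ 2 by ring.
  by rewrite mulf_eq0 pnatr_eq0 /= expf_eq0 /= (negPf (cube_neq0 (w_exp_cube _))).
rewrite -(mulrI_eq0 _ (mulfI (_ : v - u != 0))) ?subr_eq0 //.
have -> : (v - u) * (u ^+ 2 + u * v + v ^+ 2) = v ^+ 3 - u ^+ 3 by ring.
by rewrite !w_exp_cube subrr eqxx.
Qed.

Definition zeros (d e f : K) : nat :=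
  count (fun k : 'I_3 => d + e * w ^+ k + f * (w ^+ k) ^+ 2 == 0) trits.

(** Two zeros u, v determine the polynomial up to the factor f. The third cube root of unity x
    satisfies x = - (u + v) and x^2 = u v, which gives e = f x and d = f x^2. *)
Lemma zeros_two d e f : (2 <= zeros d e f)%N ->
  exists k : 'I_3, d = f * (w ^+ k) ^+ 2 /\ e = f * w ^+ k.
Proof.
have w0 := cube_neq0 w_cube; have w1 := w_neq1; have w3 := w_cube.
have key u v x : u != v -> x = - (u + v) -> x ^+ 2 = u * v ->
    d + e * u + f * u ^+ 2 = 0 -> d + e * v + f * v ^+ 2 = 0 -> d = f * x ^+ 2 /\ e = f * x.
  rewrite -subr_eq0 => uv ex -> hu hv.
  have he : e = f * x.
    apply: (mulfI uv); apply/eqP; rewrite -subr_eq0; apply/eqP.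
    transitivity ((d + e * u + f * u ^+ 2) - (d + e * v + f * v ^+ 2)); first by rewrite ex; ring.
    by rewrite hu hv subrr.
  split=> //; apply/eqP; rewrite -subr_eq0 -hu he ex; apply/eqP; ring.
have w2 : w ^+ 2 = - (1 + w) by apply/eqP; rewrite -addr_eq0 addrA addrAC -w_root; apply/eqP; ring.
have w2' : w ^+ 2 = - 1 - w by rewrite w2 opprD.
rewrite /zeros /= expr0 expr1.
(* The witness is the exponent of the cube root left out by the pair of zeros used. *)
case: eqP => h0; case: eqP => h1; case: eqP => h2 //= _.
- by exists ord_max; apply: key h0 h1 => /=; rewrite 1?eq_sym ?w2 //; ring: w2'.
- by exists ord_max; apply: key h0 h1 => /=; rewrite 1?eq_sym ?w2 //; ring: w2'.
- exists 1; apply: key h0 h2; rewrite ?expr1 ?w2' 1?eq_sym; try by ring: w2'.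
  by rewrite -w2' (w_exp_inj ord_max 0).
- exists 0; apply: key h1 h2; rewrite /= ?expr0; try by ring: w2'.
  by rewrite eq_sym (w_exp_inj ord_max 1).
Qed.

Lemma zeros_three d e f : zeros d e f = 3%N -> [/\ d = 0, e = 0 & f = 0].
Proof.
move=> h; have [|k [hd he]] := @zeros_two d e f; first by rewrite h.
suff f0 : f = 0 by rewrite hd he f0 !mul0r.
have : d + e * w ^+ k + f * (w ^+ k) ^+ 2 == 0.
  move: h; rewrite /zeros -/(size trits) => /eqP; rewrite -all_count => /allP.
  by apply; move: (k); elim/tritP.
rewrite hd he.
have -> : f * (w ^+ k) ^+ 2 + f * w ^+ k * w ^+ k + f * (w ^+ k) ^+ 2
  = 3%:R * (w ^+ k) ^+ 2 * f by ring.
have wk0 : (w ^+ k) ^+ 2 != 0 by rewrite expf_neq0 // cube_neq0 ?w_exp_cube.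
by rewrite mulf_eq0 mulf_eq0 pnatr_eq0 (negPf wk0) => /eqP.
Qed.

(** Each row has at most three zeros. Either some row has at most one, and only one D s survives,
    which is [inl s]; or every row has two, and [zeros_two] gives the recursion that defines
    [inr (i, j)]. *)
Lemma sextuple_conic D E :
  (6 <= count (fun p : 'I_3 * 'I_3 => (row_value D E p.1 (w ^+ p.2) == 0)%R)
    cusp_indices)%N ->
  (exists r, (D r != 0) || (E r != 0)) ->
  exists L c, c != 0 /\ forall r, D r = c * conic_D L r /\ E r = c * conic_E L r.
Proof.
pose n r := zeros (D r) (E (r - 1)) (E (r + 1)).
rewrite [count _ _](_ : _ = n 0%R + n 1%R + n ord_max)%N => [n6 nz|]; last first.
  by rewrite /n /zeros /row_value /= !addn0 !addnA.
have n_le r : (n r <= 3)%N by exact: count_size.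
have row r : (2 <= n r)%N ->
    exists k : 'I_3, D r = E (r + 1) * (w ^+ k) ^+ 2 /\ E (r - 1) = E (r + 1) * w ^+ k.
  exact: zeros_two.
have full r : n r = 3%N -> [/\ D r = 0, E (r - 1) = 0 & E (r + 1) = 0].
  exact: zeros_three.
have rows_case s : E 0 = 0 -> E 1 = 0 -> E ord_max = 0 ->
    (forall r, r != s -> D r = 0) ->
    exists L c, c != 0 /\ forall r, D r = c * conic_D L r /\ E r = c * conic_E L r.
  move=> E0 E1 E2 hD; have Ez r : E r = 0 by move: r; elim/tritP.
  exists (inl s), (D s); split; last first.
    move=> r; rewrite Ez /= mulr0; split=> //.
    by have [-> | /hD ->] := eqVneq r s; rewrite ?mulr1 ?mulr0.
  case: nz => r; rewrite Ez eqxx orbF.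
  by have [-> // | /hD ->] := eqVneq r s; rewrite eqxx.
(* A full row r kills E (r - 1) and E (r + 1); two zeros in a neighbouring row then kill E r and its
   constant term. *)
have next r : n r = 3%N -> (2 <= n (r + 1)%R)%N ->
    [/\ E 0 = 0, E 1 = 0, E ord_max = 0, D r = 0 & D (r + 1)%R = 0].
  move=> /full[Dr Em Ep] /row[k []]; move: r Dr Em Ep.
  by elim/tritP; rewrite !ord3E => -> e1 e2; rewrite ?e1 ?e2 mul0r => -> ->; rewrite ?mul0r.
have prev r : n r = 3%N -> (2 <= n (r - 1)%R)%N ->
    [/\ E 0 = 0, E 1 = 0, E ord_max = 0, D r = 0 & D (r - 1)%R = 0].
  have w0 := expf_neq0 _ (cube_neq0 w_cube).
  move=> /full[Dr Em Ep] /row[k []]; move: r Dr Em Ep.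
  by elim/tritP; rewrite !ord3E => -> e1 e2; rewrite ?e1 ?e2 => -> /esym/eqP;
    rewrite mulf_eq0 (negPf (w0 _)) orbF => /eqP ->; rewrite ?mul0r.
(* The other two rows share at least five zeros: one is full and the other has at least two, in
   either order. *)
have low s : (n s <= 1)%N ->
    exists L c, c != 0 /\ forall r, D r = c * conic_D L r /\ E r = c * conic_E L r.
  move=> ns; have [[a b] | [a b]] : (n (s + 1)%R = 3 /\ 2 <= n (s + 1 + 1)%R)%N
      \/ (n (s - 1)%R = 3 /\ 2 <= n (s - 1 - 1)%R)%N.
  - move: (n_le (s - 1)) (n_le (s + 1)) n6 ns.
    by move: s; elim/tritP; rewrite !ord3E; lia.
  - have [E0 E1 E2 D1 D2] := next _ a b; apply: (rows_case s) => // r.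
    by move: s r D1 D2 {ns a b}; elim/tritP; elim/tritP; rewrite !ord3E.
  - have [E0 E1 E2 D1 D2] := prev _ a b; apply: (rows_case s) => // r.
    by move: s r D1 D2 {ns a b}; elim/tritP; elim/tritP; rewrite !ord3E.
have [/low // | n0] := leqP (n 0) 1.
have [/low // | n1] := leqP (n 1) 1.
have [/low // | n2] := leqP (n ord_max) 1.
have [i [hD0 hE0]] := row _ n0; have [j [hD1 hE1]] := row _ n1.
have [k [hD2 hE2]] := row _ n2.
rewrite !ord3E in hD0 hE0 hD1 hE1 hD2 hE2.
have E1 : E 1 != 0.
  apply/eqP => E1; case: nz => r; apply/negP; rewrite negb_or !negbK.
  rewrite E1 mul0r in hE0; rewrite hE0 mul0r in hE1.
  by move: r; elim/tritP; rewrite ?hD0 ?hD1 ?hD2 ?hE0 ?hE1 ?E1 ?mul0r !eqxx.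
(* Once around the cycle of rows, E 1 is multiplied by the product of the three missed roots, which
   is therefore 1. *)
have ek : w ^+ k = w ^+ missed i j ord_max.
  have u0 : w ^+ i * w ^+ j != 0.
    by rewrite mulf_neq0 // expf_neq0 // cube_neq0 // w_cube.
  apply: (mulfI u0); rewrite (missed_prod i j).
  by apply: (mulfI E1); rewrite mulr1 {2}hE2 hE1 hE0 !mulrA.
exists (inr (i, j)), (E 1); split=> //.
elim/tritP; rewrite /conic_D !ord3E /=; split.
- by rewrite hD0 mul1r.
- by rewrite hE1 hE0 !mulrA.
- by rewrite hD1 hE0 -!mulrA.
- by rewrite mulr1.
- by rewrite hD2 ek hE1 hE0 -!mulrA.
- by rewrite hE0.
Qed.
End Sextuples.

(** * Divisibility of multivariate polynomials by vanishing *)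

Section Multivariate.
Variable R : comNzRingType.

(** Reduces identities about [muni] to constants and variables. *)
Lemma mpoly_rmorph_ext n (S : comNzRingType) (f g : {rmorphism {mpoly R[n]} -> S}) :
  (forall c, f c%:MP = g c%:MP) -> (forall i, f 'X_i = g 'X_i) -> f =1 g.
Proof.
move=> eqC eqX p; rewrite [p]mpolyE !rmorph_sum; apply: eq_bigr => m _.
rewrite -mul_mpolyC !rmorphM eqC mpolyXE_id !rmorph_prod; congr (_ * _).
by apply: eq_bigr => i _; rewrite !rmorphXn eqX.
Qed.

Lemma muniXU_widen n (j : 'I_n) :
  muni ('X_(widen_ord (leqnSn n) j) : {mpoly R[n.+1]}) = ('X_j)%:P.
Proof.
rewrite muniE msuppX big_seq1 mcoeffX eqxx scale1r mnm1E.
rewrite [_ == ord_max](_ : _ = false) ?expr0 -?mul_polyC ?mulr1; last first.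
  by apply/negP => /eqP/(congr1 val)/= e; have := ltn_ord j; rewrite e ltnn.
congr ('X_[_])%:P; apply/mnmP => i; rewrite mnmE !mnm1E.
by congr nat_of_bool; apply/eqP/eqP => [/(congr1 val)/= /val_inj | ->].
Qed.

Lemma muniXU_max n : muni ('X_(@ord_max n) : {mpoly R[n.+1]}) = 'X.
Proof.
rewrite muniE msuppX big_seq1 mcoeffX eqxx scale1r mnm1E eqxx expr1.
rewrite (_ : [multinom _ | i < n] = 0%MM) ?mpolyX0 ?scale1r //.
apply/mnmP => i; rewrite mnmE mnm1E mnm0E; case: eqP => // /(congr1 val)/= e.
by have := ltn_ord i; rewrite -e ltnn.
Qed.

Lemma ord_maxP n (P : 'I_n.+1 -> Prop) :
  (forall j : 'I_n, P (widen_ord (leqnSn n) j)) -> P ord_max -> forall i, P i.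
Proof.
move=> Pw Pm i; have [/eqP h | h] := boolP (i == ord_max); first by rewrite h.
have lt_in : (i < n)%N.
  by rewrite ltn_neqAle -ltnS ltn_ord andbT; apply: contraNneq h => e; apply/eqP/val_inj.
by have := Pw (Ordinal lt_in); congr P; apply: val_inj.
Qed.

(** Inverts [muni]: the coefficients are widened and the last variable is substituted. *)
Definition horner_max n (p : {poly {mpoly R[n]}}) : {mpoly R[n.+1]} :=
  (map_poly (@mwiden n R) p).['X_ord_max].

Lemma horner_maxM n (p q : {poly {mpoly R[n]}}) :
  horner_max (p * q) = horner_max p * horner_max q.
Proof. by rewrite /horner_max rmorphM hornerM. Qed.

Lemma muniK n : cancel (@muni n R) (@horner_max n).
Proof.
move=> p.
pose f := horner_eval ('X_ord_max : {mpoly R[n.+1]}) \o map_poly (@mwiden n R)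
  \o @muni n R.
apply: (@mpoly_rmorph_ext _ _ f idfun) => [c | ] /=.
  by rewrite /horner_eval muniC map_polyC hornerC /= mwidenC.
apply: ord_maxP => [j|]; rewrite /horner_eval.
  by rewrite muniXU_widen map_polyC hornerC /= mwidenX mnmwiden1.
by rewrite muniXU_max map_polyX hornerX.
Qed.

Lemma meval_muni n (p : {mpoly R[n.+1]}) (v : 'I_n.+1 -> R) :
  p.@[v] = (map_poly (meval (fun j => v (widen_ord (leqnSn n) j))) (muni p)).[v ord_max].
Proof.
set v' := fun j => _.
pose f := horner_eval (v ord_max) \o map_poly (meval v') \o @muni n R.
apply: (@mpoly_rmorph_ext _ _ (meval v) f) => [c | ] /=.
  by rewrite /horner_eval mevalC muniC map_polyC hornerC /= mevalC.
apply: ord_maxP => [j|]; rewrite /horner_eval mevalXU.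
  by rewrite muniXU_widen map_polyC hornerC /= mevalXU.
by rewrite muniXU_max map_polyX hornerX.
Qed.
End Multivariate.

Lemma poly_vanish (K : numDomainType) (p : {poly K}) : (forall x, p.[x] = 0) -> p = 0.
Proof.
move=> h; apply: (@roots_geq_poly_eq0 _ p [seq i%:R | i <- iota 0 (size p)]).
- by apply/allP => x _; apply/eqP/h.
- by rewrite map_inj_uniq ?iota_uniq //; apply: mulrIn; rewrite oner_eq0.
- by rewrite size_map size_iota.
Qed.

Lemma mpoly_vanish (K : numDomainType) n (p : {mpoly K[n]}) :
  (forall v, p.@[v] = 0) -> p = 0.
Proof.
elim: n p => [|n IHn] p h.
  by rewrite [p]nvar0_mpolyC; have := h (fun=> 0); rewrite {1}[p]nvar0_mpolyC mevalC => ->.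
rewrite -[p]muniK (_ : muni p = 0) ?/horner_max ?map_poly0 ?horner0 //.
apply/polyP => i; rewrite coef0; apply: IHn => v'.
rewrite -coef_map; have -> : map_poly (meval v') (muni p) = 0; last by rewrite coef0.
apply: poly_vanish => x.
rewrite -(h (fun i => if unlift ord_max i is Some j then v' j else x)) meval_muni unlift_none.
congr (horner _ _); apply: eq_map_poly => q; apply: meval_eq => j.
rewrite (_ : widen_ord _ j = lift ord_max j) ?liftK //.
exact/val_inj/esym/lift_max.
Qed.

(** Divide G by the monic F in the last variable. Where D does not vanish, the specialised remainder
    has more roots than its degree, so it is zero. Hence D times each coefficient of the remainder
    vanishes everywhere, and D != 0. *)
Lemma mpoly_divides (K : numDomainType) n (F G : {mpoly K[n.+1]}) (D : {mpoly K[n]}) :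
  muni F \is monic -> D != 0 ->
  (forall v : 'I_n -> K, D.@[v] != 0 -> exists s : seq K,
     [/\ uniq s, ((size (muni F)).-1 <= size s)%N
       & {in s, forall t, (map_poly (meval v) (muni F)).[t] = 0
                       /\ (map_poly (meval v) (muni G)).[t] = 0}]) ->
  exists H, G = H * F.
Proof.
move=> monF D0 hs; pose q := muni G %/ muni F; pose r := muni G %% muni F.
have divE : muni G = q * muni F + r by exact: Pdiv.IdomainMonic.divp_eq.
have size_r : (size r < size (muni F))%N by rewrite ltn_modp monic_neq0.
clearbody q r; suff r0 : r = 0.
  by exists (horner_max q); rewrite -[G]muniK divE r0 addr0 horner_maxM muniK.
apply/polyP => i; rewrite coef0; apply/eqP; rewrite -(mulIr_eq0 _ (mulIf D0)).
apply/eqP/mpoly_vanish => v; rewrite mevalM.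
have [-> | Dv] := eqVneq D.@[v] 0; first by rewrite mulr0.
have [s [us szs hsv]] := hs v Dv.
suff rv : map_poly (meval v) r = 0 by rewrite -coef_map rv coef0 mul0r.
apply: (@roots_geq_poly_eq0 _ _ s) => //.
  apply/allP => t /hsv[ft gt]; apply/eqP; rewrite -gt divE.
  by rewrite rmorphD rmorphM hornerD hornerM ft mulr0 add0r.
apply: leq_trans szs; apply: leq_trans (size_poly _ _) _.
by rewrite -ltnS prednK // size_poly_gt0 monic_neq0.
Qed.

Lemma sextic_rmorph (A B : comNzRingType) (f : {rmorphism A -> B}) l a b c :
  f (sextic l a b c) = sextic (f l) (f a) (f b) (f c).
Proof. by rewrite /sextic; ring. Qed.

Lemma hesse_rmorph (A B : comNzRingType) (f : {rmorphism A -> B}) l a b c :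
  f (hesse l a b c) = hesse (f l) (f a) (f b) (f c).
Proof. by rewrite /hesse; ring. Qed.

(** * The sextic as a monic polynomial in its last variable *)

Section SexticPolynomial.
Variable A : comNzRingType.
Implicit Types l a b : A.

Definition sextic_tail l a b : {poly A} := Poly [::
  a ^+ 6 + b ^+ 6 - (2%:R - 4%:R * l ^+ 3) * (a ^+ 3 * b ^+ 3);
  - 6%:R * l ^+ 2 * (a * b) * (a ^+ 3 + b ^+ 3);
  - (3%:R * l ^+ 4 - 12%:R * l) * (a * b) ^+ 2;
  - (2%:R - 4%:R * l ^+ 3) * (a ^+ 3 + b ^+ 3);
  - 6%:R * l ^+ 2 * (a * b)].

Lemma sextic_polyE l a b :
  sextic l%:P a%:P b%:P 'X = 'X^6 + sextic_tail l a b.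
Proof.
by rewrite /sextic_tail /Poly /= !cons_poly_def /sextic; ring.
Qed.

Lemma size_sextic_tail l a b : (size (sextic_tail l a b) < size ('X^6 : {poly A}))%N.
Proof. by rewrite size_polyXn ltnS (leq_trans (size_Poly _)). Qed.

Lemma size_sextic_poly l a b : size (sextic l%:P a%:P b%:P 'X) = 7%N.
Proof. by rewrite sextic_polyE size_polyDl ?size_sextic_tail // size_polyXn. Qed.

Lemma sextic_poly_monic l a b : sextic l%:P a%:P b%:P 'X \is monic.
Proof. by rewrite sextic_polyE monicE lead_coefDl ?size_sextic_tail // lead_coefXn. Qed.

Lemma horner_sextic l a b t : (sextic l%:P a%:P b%:P 'X).[t] = sextic l a b t.
Proof. by rewrite -/(horner_eval t _) sextic_rmorph /= /horner_eval !hornerC hornerX. Qed.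

Lemma horner_deriv_sextic l a b t :
  (sextic l%:P a%:P b%:P 'X)^`().[t] = dsextic l t a b.
Proof.
by rewrite sextic_polyE /sextic_tail /Poly /= !cons_poly_def /dsextic
  !derivE !hornerE /=; ring.
Qed.
End SexticPolynomial.

Lemma sextic_roots (K : numClosedFieldType) (l a b : K) : l ^+ 3 != 1 ->
  (a ^+ 3 - b ^+ 3) * (a ^+ 3 - l ^+ 3 * b ^+ 3) * (b ^+ 3 - l ^+ 3 * a ^+ 3) != 0 ->
  exists s : seq K, [/\ uniq s, size s = 6%N & {in s, forall t, sextic l a b t = 0}].
Proof.
move=> l3 nz; pose p := sextic l%:P a%:P b%:P 'X.
have [s] := closed_field_poly_normal p; rewrite (monicP (sextic_poly_monic _ _ _)) scale1r => ps.
exists s; split.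
(* The roots are distinct because the polynomial is coprime to its derivative: a common root is
   excluded by [sextic_simple_roots]. *)
- rewrite -separable_prod_XsubC -ps unlock.
  apply: Pdiv.ClosedField.root_coprimep => t; rewrite /root horner_sextic => /eqP h.
  by rewrite horner_deriv_sextic; apply: sextic_simple_roots.
- by apply: succn_inj; rewrite -(size_prod_XsubC s id) -ps size_sextic_poly.
by move=> t ts; rewrite -horner_sextic; apply/eqP; rewrite -/(root _ _) -/p ps root_prod_XsubC.
Qed.

(** * The equation of the dual curve *)

Section PlaneCurves.
Variable K : fieldType.
Implicit Types (v : 'rV[K]_3) (l a b c : K).

Definition dual_sextic l : {mpoly K[3]} := sextic l%:MP 'X_0 'X_1 'X_ord_max.

Lemma meval_dual_sextic l v :
  (dual_sextic l).@[v 0] = sextic l (v 0 0) (v 0 1) (v 0 ord_max).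
Proof. by rewrite sextic_rmorph /= mevalC !mevalXU. Qed.

Lemma hesse_cubicE l : hesse_cubic l = hesse l%:MP 'X_0 'X_1 'X_ord_max.
Proof.
rewrite /hesse_cubic !big_ord_recl !big_ord0.
have -> : lift ord0 (ord0 : 'I_2) = 1 by apply: val_inj.
have -> : lift ord0 (lift ord0 (ord0 : 'I_1)) = ord_max by apply: val_inj.
by rewrite /hesse -mul_mpolyC mpolyCM -[ord0]/(0 : 'I_3); ring.
Qed.

Lemma meval_hesse_cubic l v :
  (hesse_cubic l).@[v 0] = hesse l (v 0 0) (v 0 1) (v 0 ord_max).
Proof. by rewrite hesse_cubicE hesse_rmorph /= mevalC !mevalXU. Qed.

Definition row3 a b c : 'rV[K]_3 := \row_i nth 0 [:: a; b; c] i.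

Lemma row3E a b c : (((row3 a b c) 0 0 = a) * ((row3 a b c) 0 1 = b)
  * ((row3 a b c) 0 ord_max = c))%type.
Proof. by rewrite !mxE. Qed.

Lemma row3_eta v : row3 (v 0 0) (v 0 1) (v 0 ord_max) = v.
Proof. by apply/rowP; elim/tritP; rewrite !mxE. Qed.

Lemma row3_eq0 a b c : (row3 a b c == 0) = [&& a == 0, b == 0 & c == 0].
Proof.
apply/eqP/and3P => [h | [/eqP-> /eqP-> /eqP->]].
  by have := row3E a b c; rewrite h !mxE => -[[<- <-] <-].
by apply/rowP; elim/tritP; rewrite !mxE.
Qed.

Lemma scale_row3 k a b c : k *: row3 a b c = row3 (k * a) (k * b) (k * c).
Proof. by apply/rowP; elim/tritP; rewrite !mxE. Qed.

Lemma mderivXU (i j : 'I_3) : ('X_i : {mpoly K[3]})^`M(j) = (i == j)%:R.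
Proof.
rewrite mderivX mnm1E; case: eqP => [-> | _]; last by rewrite scale0r.
by rewrite scale1r -{1}[U_(j)%MM]add0m addmK mpolyX0.
Qed.

Lemma gradient_hesse l x y z : gradient (hesse_cubic l) (row3 x y z)
  = 3%:R *: row3 (x ^+ 2 - l * (y * z)) (y ^+ 2 - l * (z * x)) (z ^+ 2 - l * (x * y)).
Proof.
(* Powers are written as products so that the Leibniz rule applies. *)
have -> : hesse_cubic l = 'X_0 * 'X_0 * 'X_0 + 'X_1 * 'X_1 * 'X_1
    + 'X_ord_max * 'X_ord_max * 'X_ord_max
    - (3%:R * l)%:MP * ('X_0 * 'X_1 * 'X_ord_max).
  by rewrite hesse_cubicE /hesse; ring.
rewrite scale_row3; apply/rowP => j; rewrite !mxE.
rewrite !(mderivB, mderivD, mderivM, mderivC, mderivXU).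
rewrite !(mevalB, mevalD, mevalM, mevalC, mevalXU, meval0, rmorph_nat, row3E).
by move: j; elim/tritP; rewrite /=; ring.
Qed.

Lemma line_proof v : v != 0 -> \dim <[v]>%VS == 1%N.
Proof. by rewrite dim_vline => ->. Qed.

Definition proj_point v (nz : v != 0) : proj_plane K := exist _ <[v]>%VS (line_proof nz).

Lemma lineZ k v : k != 0 -> <[k *: v]>%VS = <[v]>%VS.
Proof.
move=> k0; apply/eqP; rewrite eqEsubv -!memvE; apply/andP; split.
  by rewrite memvZ ?memv_line.
by apply/vlineP; exists k^-1; rewrite scalerA mulVf // scale1r.
Qed.
End PlaneCurves.

Section DualCurve.
Variables (K : numClosedFieldType) (l : K).
Hypothesis l_cube : l ^+ 3 != 1.
Implicit Types (v : 'rV[K]_3) (p : proj_plane K).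

Lemma dual_curve_vanishes p : dual_curve (hesse_cubic l) p -> vanishes_at (dual_sextic l) p.
Proof.
move=> [v [_ hv _ pv]] w; rewrite pv => /vlineP[k ->].
rewrite -(row3_eta v) gradient_hesse scalerA scale_row3.
rewrite meval_hesse_cubic in hv.
rewrite meval_dual_sextic !row3E.
have hom (m a b c : K) : sextic l (m * a) (m * b) (m * c) = m ^+ 6 * sextic l a b c.
  by rewrite /sextic; ring.
by rewrite hom sextic_gradient // mulr0.
Qed.

Lemma sextic_dual_curve v (nz : v != 0) : (dual_sextic l).@[v 0] = 0 ->
  dual_curve (hesse_cubic l) (proj_point nz).
Proof.
rewrite meval_dual_sextic => h.
have nz' : [|| v 0 0 != 0, v 0 1 != 0 | v 0 ord_max != 0].
  by move: nz; rewrite -{1}(row3_eta v) row3_eq0 !negb_and.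
have [x [y [z [k [hxyz xyz0 k0 [ea eb ec]]]]]] := sextic_on_dual l_cube h nz'.
have n3 : (3%:R : K) != 0 by rewrite pnatr_eq0.
have ev : v = (k / 3%:R) *: gradient (hesse_cubic l) (row3 x y z).
  by rewrite gradient_hesse scalerA divfK // scale_row3 -ea -eb -ec row3_eta.
have k3 : k / 3%:R != 0 by rewrite mulf_neq0 ?invr_eq0.
exists (row3 x y z); split.
- by rewrite row3_eq0 !negb_and.
- by rewrite meval_hesse_cubic !row3E.
- by apply: contraNneq nz => g0; rewrite ev g0 scaler0.
by rewrite /= {1}ev lineZ.
Qed.

Lemma muni_dual_sextic : muni (dual_sextic l) = sextic (l%:MP)%:P ('X_0)%:P ('X_1)%:P 'X.
Proof.
rewrite sextic_rmorph /= muniC muniXU_max.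
have -> : (0 : 'I_3) = widen_ord (leqnSn 2) 0 by apply: val_inj.
have -> : (1 : 'I_3) = widen_ord (leqnSn 2) 1 by apply: val_inj.
by rewrite !muniXU_widen.
Qed.

Lemma dual_sextic_equation : equation_of (dual_sextic l) (dual_curve (hesse_cubic l)).
Proof.
move=> G; split; last first.
  move=> [H ->] p hp v vp; rewrite mevalM.
  by rewrite (dual_curve_vanishes hp vp) mulr0.
move=> hG.
(* D vanishes on the lines joining (0 : 0 : 1) to the cusps; on any other line through that point
   the sextic has six distinct zeros. *)
pose D : {mpoly K[2]} := ('X_0 ^+ 3 - 'X_1 ^+ 3) * ('X_0 ^+ 3 - (l ^+ 3)%:MP * 'X_1 ^+ 3)
  * ('X_1 ^+ 3 - (l ^+ 3)%:MP * 'X_0 ^+ 3).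
have DE (v : 'I_2 -> K) : D.@[v] = (v 0 ^+ 3 - v 1 ^+ 3) * (v 0 ^+ 3 - l ^+ 3 * v 1 ^+ 3)
    * (v 1 ^+ 3 - l ^+ 3 * v 0 ^+ 3).
  by rewrite /D !(mevalM, mevalB, rmorphXn, mevalC, mevalXU).
apply: (@mpoly_divides _ _ _ _ D).
- by rewrite muni_dual_sextic sextic_poly_monic.
(* Each factor of D takes the value 1 at (1, 0) or at (0, 1). *)
- have nzD (q : {mpoly K[2]}) (u : 'I_2 -> K) : q.@[u] = 1 -> q != 0.
    by move=> h; apply/eqP => q0; move/eqP: h; rewrite q0 meval0 eq_sym oner_eq0.
  rewrite /D !mulf_neq0 //; [apply: (nzD _ (fun i => (i == 0)%:R)) |
    apply: (nzD _ (fun i => (i == 0)%:R)) | apply: (nzD _ (fun i => (i == 1)%:R))];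
  by rewrite !(mevalB, rmorphXn, mevalM, mevalC, mevalXU) /= !mevalXU
    !(expr0n, expr1n) /= ?mulr0 subr0.
move=> v Dv; rewrite DE in Dv.
have [s [us szs hs]] := sextic_roots l_cube Dv; exists s; split=> //.
  by rewrite muni_dual_sextic size_sextic_poly szs.
move=> t /hs ht; split.
  rewrite muni_dual_sextic sextic_rmorph /= !map_polyC map_polyX /= !mevalXU mevalC.
  by rewrite horner_sextic.
have nz : row3 (v 0) (v 1) t != 0.
  rewrite row3_eq0; apply: contraNN Dv => /and3P[/eqP-> /eqP-> _].
  by rewrite subrr !mul0r.
rewrite -(hG _ (@sextic_dual_curve _ nz _) _ (memv_line _)).
  rewrite meval_muni row3E; congr horner; apply: eq_map_poly => q; apply: meval_eq.
  by case=> [[|[|//]]] i; rewrite mxE /=; congr v; apply: val_inj.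
by rewrite meval_dual_sextic !row3E.
Qed.

(** [cusps] allows any equation F of the dual curve; this carries its singular points over to the
    explicit sextic. *)
Lemma equation_divides F : equation_of F (dual_curve (hesse_cubic l)) ->
  exists H, dual_sextic l = H * F.
Proof. by move=> h; apply/h => p; apply: dual_curve_vanishes. Qed.
End DualCurve.

(** * The cusps of the dual curve *)

Section LocalEquations.
Variable K : fieldType.
Implicit Types (p q : {mpoly K[2]}) (i : 'I_2).

Lemma mdeg2 (m : 'X_{1..2}) : mdeg m = (m 0%R + m 1%R)%N.
Proof.
rewrite mdegE !big_ord_recl big_ord0 addn0; congr (m _ + m _)%N; exact: val_inj.
Qed.

Lemma mcoeff_mulXn p i k (m : 'X_{1..2}) : (m i < k)%N -> (p * 'X_i ^+ k)@_m = 0.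
Proof.
move=> mik; rewrite mpolyXn; apply: memN_msupp_eq0.
rewrite (perm_mem (msuppMX _ _)); apply/mapP => -[m' _ em].
by move: mik; rewrite em mnmDE mulmnE mnm1E eqxx mul1n ltnNge leq_addr.
Qed.

Lemma mcoeff0M p q : (p * q)@_0%MM = p@_0%MM * q@_0%MM.
Proof. exact: rmorphM. Qed.

Lemma mcoeffU_deriv p i : p@_U_(i) = (p^`M(i))@_0%MM.
Proof. by rewrite mcoeff_deriv add0m mnm0E. Qed.

Lemma mcoeffU_mul p q i : (p * q)@_U_(i) = p@_U_(i) * q@_0%MM + p@_0%MM * q@_U_(i).
Proof. by rewrite !mcoeffU_deriv mderivM mcoeffD !mcoeff0M. Qed.

Lemma local_equation_mul (F G : {mpoly K[3]}) (B : 'M[K]_3) :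
  local_equation (F * G) B = local_equation F B * local_equation G B.
Proof. by rewrite /local_equation rmorphM. Qed.

Definition chart (B : 'M[K]_3) (j : 'I_3) : {mpoly K[2]} :=
  (B 0 j)%:MP + B 1 j *: 'X_0 + B ord_max j *: 'X_1.

Lemma local_dual_sextic l (B : 'M[K]_3) :
  local_equation (dual_sextic l) B
  = sextic l%:MP (chart B 0) (chart B 1) (chart B ord_max).
Proof.
rewrite /local_equation sextic_rmorph /= comp_mpolyC !comp_mpolyXU.
by rewrite -!tnth_nth !tnth_mktuple.
Qed.

Lemma mderiv_sextic (l : K) (a b c : {mpoly K[2]}) i :
  (sextic l%:MP a b c : {mpoly K[2]})^`M(i) = a^`M(i) * dsextic l%:MP a b c
    + b^`M(i) * dsextic l%:MP b c a + c^`M(i) * dsextic l%:MP c a b.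
Proof.
have -> : sextic l%:MP a b c =
    a * a * a * a * a * a + b * b * b * b * b * b + c * c * c * c * c * c
  - (2%:R - 4%:R * l ^+ 3)%:MP
    * ((a * a * a) * (b * b * b) + (b * b * b) * (c * c * c) + (c * c * c) * (a * a * a))
  - (6%:R * l ^+ 2)%:MP * ((a * b * c) * (a * a * a + b * b * b + c * c * c))
  - (3%:R * l ^+ 4 - 12%:R * l)%:MP * (a * b * c * (a * b * c)).
  by rewrite /sextic; ring.
rewrite !(mderivB, mderivD, mderivM, mderivC) /dsextic; ring.
Qed.

Lemma mcoeff0_chart (B : 'M[K]_3) j : (chart B j)@_0%MM = B 0 j.
Proof. by rewrite !mcoeffD !mcoeffZ mcoeffC !mcoeffX !mnm1_eq0 eqxx !mulr0 mulr1 !addr0. Qed.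

Lemma mcoeffU_chart (B : 'M[K]_3) j i : (chart B j)@_U_(i) = B (lift 0 i) j.
Proof.
rewrite !mcoeffD !mcoeffZ mcoeffC !mcoeffXU mnm1_eq0 mulr0 add0r.
case: i => [[|[|//]]] h /=; rewrite ?mulr1 ?mulr0 ?addr0 ?add0r;
congr (B _ _); exact: val_inj.
Qed.

Lemma dsextic_rmorph (A A' : comNzRingType) (f : {rmorphism A -> A'}) l a b c :
  f (dsextic l a b c) = dsextic (f l) (f a) (f b) (f c).
Proof. by rewrite /dsextic; ring. Qed.

Lemma mcoeff0_sextic l (a b c : {mpoly K[2]}) :
  (sextic l%:MP a b c : {mpoly K[2]})@_0%MM = sextic l a@_0%MM b@_0%MM c@_0%MM.
Proof.
rewrite -[l in RHS](mpolyCK 2).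
exact: (sextic_rmorph (mcoeff 0%MM : {rmorphism {mpoly K[2]} -> K})).
Qed.

Lemma mcoeff0_dsextic l (a b c : {mpoly K[2]}) :
  (dsextic l%:MP a b c : {mpoly K[2]})@_0%MM = dsextic l a@_0%MM b@_0%MM c@_0%MM.
Proof.
rewrite -[l in RHS](mpolyCK 2).
exact: (dsextic_rmorph (mcoeff 0%MM : {rmorphism {mpoly K[2]} -> K})).
Qed.

Lemma mcoeffU_sextic l (a b c : {mpoly K[2]}) i
  (a0 := a@_0%MM) (b0 := b@_0%MM) (c0 := c@_0%MM) :
  (sextic l%:MP a b c : {mpoly K[2]})@_U_(i) = a@_U_(i) * dsextic l a0 b0 c0
    + b@_U_(i) * dsextic l b0 c0 a0 + c@_U_(i) * dsextic l c0 a0 b0.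
Proof.
rewrite mcoeffU_deriv mderiv_sextic !mcoeffD !mcoeff0M -!mcoeffU_deriv.
by rewrite !mcoeff0_dsextic.
Qed.

(** B times the gradient of the sextic at the first row of B is zero: the first entry by Euler's
    relation, the other two because they are the linear coefficients of g. As B is invertible, the
    gradient vanishes. *)
Lemma local_sextic_singular l (B : 'M[K]_3) (g := local_equation (dual_sextic l) B)
  (d := dsextic l) : B \in unitmx ->
  g@_0%MM = 0 -> (forall i, g@_U_(i) = 0) ->
  sextic l (B 0 0) (B 0 1) (B 0 ord_max) = 0 /\
  d (B 0 0) (B 0 1) (B 0 ord_max) = 0.
Proof.
rewrite /g local_dual_sextic => uB g0 gU.
have h : sextic l (B 0 0) (B 0 1) (B 0 ord_max) = 0.
  by rewrite -g0 mcoeff0_sextic !mcoeff0_chart.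
split=> //.
pose N : 'cV[K]_3 := \col_i nth 0 [:: d (B 0 0) (B 0 1) (B 0 ord_max);
  d (B 0 1) (B 0 ord_max) (B 0 0); d (B 0 ord_max) (B 0 0) (B 0 1)] i.
have rowN (i : 'I_3) : (B *m N) i 0 = B i 0 * d (B 0 0) (B 0 1) (B 0 ord_max)
   + B i 1 * d (B 0 1) (B 0 ord_max) (B 0 0) + B i ord_max * d (B 0 ord_max) (B 0 0) (B 0 1).
  rewrite mxE !big_ord_recl big_ord0 !mxE addr0 addrA /=.
  by congr (B i _ * _ + B i _ * _ + B i _ * _); apply: val_inj.
have BN : B *m N = 0.
  apply/colP => i; rewrite rowN mxE.
  have [->|[j ->]] : i = 0 \/ exists j : 'I_2, i = lift 0 j.
    by case: (unliftP 0 i) => [j ->|->]; [right; exists j | left].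
    transitivity (6%:R * sextic l (B 0 0) (B 0 1) (B 0 ord_max)); last by rewrite h mulr0.
    by rewrite /d /dsextic /sextic; ring.
  by rewrite -(gU j) mcoeffU_sextic !mcoeffU_chart !mcoeff0_chart.
have N0 : N = 0 by rewrite -(mulKmx uB N) BN mulmx0.
by have := congr1 (fun M : 'cV[K]_3 => M 0 0) N0; rewrite !mxE.
Qed.
End LocalEquations.

Section Cusps.
Variables (K : numClosedFieldType) (l : K).
Hypothesis l_cube : l ^+ 3 != 1.

Definition cusp_row (r : 'I_3) (u : K) : 'rV[K]_3 :=
  row3 (cusp_coord l r u).1.1 (cusp_coord l r u).1.2 (cusp_coord l r u).2.

Lemma cusp_row_neq0 r u : u ^+ 3 = 1 -> cusp_row r u != 0.
Proof.
move=> u3; have u0 := cube_neq0 u3; rewrite row3_eq0 !negb_and.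
by move: r; elim/tritP; rewrite /= ?expf_neq0 ?u0 ?orbT.
Qed.

(** The 1-jet of F at a cusp is zero, hence so is that of its multiple [dual_sextic l], and
    [sextic_singular] applies. *)
Lemma cusps_sub p : cusps (dual_curve (hesse_cubic l)) p ->
  exists r u, u ^+ 3 = 1 /\ val p = <[cusp_row r u]>%VS.
Proof.
move=> [F /equation_divides[H FE] [B []]]; set g := local_equation F B.
move=> uB pB g2 _.
have g_low (m : 'X_{1..2}) : (mdeg m <= 1)%N -> g@_m = 0.
  move=> hm; apply/eqP/negbFE; rewrite g2 ?(leq_trans hm) //.
  by apply: contraTF hm => /eqP ->; rewrite mdegMn mdeg1.
have [h d] : sextic l (B 0 0) (B 0 1) (B 0 ord_max) = 0 /\
    dsextic l (B 0 0) (B 0 1) (B 0 ord_max) = 0.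
  apply: local_sextic_singular => // [|i]; rewrite FE local_equation_mul -/g.
    by rewrite mcoeff0M (g_low 0%MM) ?mdeg0 // mulr0.
  by rewrite mcoeffU_mul (g_low 0%MM) ?(g_low U_(i)%MM) ?mdeg0 ?mdeg1 // !mulr0 addr0.
have B0 : row 0 B != 0.
  apply/eqP => B0; have := congr1 (fun N => row 0 N) (mulmxV uB).
  rewrite row_mul B0 mul0mx => /rowP/(_ 0); rewrite !mxE /= => /esym/eqP.
  by rewrite oner_eq0.
have := B0; rewrite -(row3_eta (row 0 B)) row3_eq0 !negb_and !mxE => nz.
have [r [u [m [u3 m0 [e1 e2 e3]]]]] := sextic_singular l_cube h nz d.
exists r, u; split=> //; rewrite pB -[RHS](lineZ _ m0) /cusp_row scale_row3 -e1 -e2 -e3.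
by rewrite -[row _ _]row3_eta !mxE.
Qed.

Definition cusp_shift (r : 'I_3) (x y z : K) : 'rV[K]_3 :=
  match val r with
  | 0%N => row3 x y z | 1%N => row3 z x y | _ => row3 y z x
  end.

Lemma cusp_rowE r u : cusp_row r u = cusp_shift r l u (u ^+ 2).
Proof. by move: r; elim/tritP. Qed.

(** Expansion around (L : 1 : 1). The first two terms are the A_2 normal form; every other term is
    divisible by s^2 t, s^4 or t^4. *)
Lemma sextic_chart (A : comNzRingType) (L s t : A) :
  sextic L (L + t) (1 + s) (1 - s)
  = 36%:R * (L ^+ 3 - 1) ^+ 2 * s ^+ 2 + 4%:R * (L ^+ 3 - 1) * t ^+ 3
    + ((6%:R * L ^+ 2 * t ^+ 3 + (48%:R * L ^+ 3 - 12%:R) * t ^+ 2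
         + (114%:R * L ^+ 4 - 60%:R * L) * t + 108%:R * (L ^+ 5 - L ^+ 2)) * t) * s ^+ 2
    + (24%:R + 4%:R * (1 - L ^+ 3) * s ^+ 2 + (12%:R * L - 3%:R * L ^+ 4) * t ^+ 2
         + (60%:R * L ^+ 2 - 6%:R * L ^+ 5) * t + 60%:R * L ^+ 3 - 3%:R * L ^+ 6) * s ^+ 4
    + (t + 3%:R * L) ^+ 2 * t ^+ 4.
Proof. rewrite /sextic; ring. Qed.

(* The second and third rows span the directions transverse and tangent to the cusp. *)
Definition cusp_frame r u : 'M[K]_3 := \matrix_(i < 3)
  nth 0 [:: cusp_shift r l u (u ^+ 2); cusp_shift r 0 u (- u ^+ 2); cusp_shift r 1 0 0] i.

Lemma chart_cusp_frame r u (j : 'I_3) : chart (cusp_frame r u) j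
  = (cusp_shift r l u (u ^+ 2) 0 j)%:MP + (cusp_shift r 0 u (- u ^+ 2) 0 j) *: 'X_0
    + (cusp_shift r 1 0 0 0 j) *: 'X_1.
Proof. by rewrite /chart !mxE. Qed.

Lemma cusp_frame_unit r u : u ^+ 3 = 1 -> cusp_frame r u \in unitmx.
Proof.
move=> u3; have u0 := cube_neq0 u3.
have n2 : (2%:R : K) != 0 by rewrite pnatr_eq0.
rewrite -row_free_unit; apply: inj_row_free => v vB.
have e j : v 0 0 * cusp_shift r l u (u ^+ 2) 0 j + v 0 1 * cusp_shift r 0 u (- u ^+ 2) 0 j
    + v 0 ord_max * cusp_shift r 1 0 0 0 j = 0.
  transitivity ((v *m cusp_frame r u) 0 j); last by rewrite vB mxE.
  rewrite mxE !big_ord_recl big_ord0 addr0 addrA !mxE /=.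
  by congr (v 0 _ * _ + v 0 _ * _ + v 0 _ * _); apply: val_inj.
have [e0 [e1 e2]] : v 0 0 * l + v 0 ord_max = 0 /\
    (v 0 0 + v 0 1) * u = 0 /\ (v 0 0 - v 0 1) * u ^+ 2 = 0.
  have := e 0; have := e 1; have := e ord_max; rewrite /cusp_shift {e vB}.
  by move: r; elim/tritP; rewrite /= !row3E => h2 h1 h0; do !split;
    first [rewrite -[RHS]h0; ring | rewrite -[RHS]h1; ring | rewrite -[RHS]h2; ring].
move/eqP: e1; rewrite mulf_eq0 (negPf u0) orbF addr_eq0 => /eqP v0.
move/eqP: e2; rewrite mulf_eq0 (negPf (expf_neq0 2 u0)) orbF v0 -opprD oppr_eq0.
rewrite -mulr2n -mulr_natl mulf_eq0 (negPf n2) /= => /eqP v1.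
rewrite v0 v1 oppr0 mul0r add0r in e0.
by rewrite -[v]row3_eta v0 v1 e0 oppr0; apply/eqP; rewrite row3_eq0 eqxx.
Qed.

(** The sextic is invariant under cyclic shifts and under (a, b, c) |-> (a, u b, u^2 c), so every
    cusp has the local equation of (l : 1 : 1). *)
Lemma local_equation_cusp r u : u ^+ 3 = 1 ->
  local_equation (dual_sextic l) (cusp_frame r u)
  = sextic l%:MP (l%:MP + 'X_1) (1 + 'X_0) (1 - 'X_0).
Proof.
move=> u3; have u3' : u%:MP ^+ 3 = 1 :> {mpoly K[2]} by rewrite -rmorphXn u3.
have -> : sextic l%:MP (l%:MP + 'X_1) (1 + 'X_0) (1 - 'X_0) =
   sextic l%:MP (l%:MP + 'X_1) (u%:MP * (1 + 'X_0)) (u%:MP ^+ 2 * (1 - 'X_0)) :> {mpoly K[2]}.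
  by rewrite /sextic; ring: u3'.
set a := l%:MP + 'X_1; set b := u%:MP * _; set c := u%:MP ^+ 2 * _.
have ea : l%:MP + 0 *: 'X_0 + 1 *: 'X_1 = a by rewrite scale0r scale1r addr0.
have eb : u%:MP + u *: 'X_0 + 0 *: 'X_1 = b by rewrite /b scale0r addr0 -mul_mpolyC mulrDr mulr1.
have ec : (u ^+ 2)%:MP + (- u ^+ 2) *: 'X_0 + 0 *: 'X_1 = c.
  by rewrite /c scale0r addr0 scaleNr -mul_mpolyC rmorphXn mulrBr mulr1.
rewrite local_dual_sextic !chart_cusp_frame /cusp_shift.
by move: r; elim/tritP; rewrite /= !row3E ea eb ec // sextic_cyc // sextic_cyc.
Qed.

Lemma mcoeff_sextic_chart (m : 'X_{1..2}) :
  ((m 0%R + m 1%R <= 2) || (m 0%R == 0) && (m 1%R <= 3))%N ->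
  (sextic l%:MP (l%:MP + 'X_1) (1 + 'X_0) (1 - 'X_0))@_m
  = 36%:R * (l ^+ 3 - 1) ^+ 2 * ((U_(0%R) *+ 2)%MM == m)%:R
    + 4%:R * (l ^+ 3 - 1) * ((U_(1%R) *+ 3)%MM == m)%:R.
Proof.
move=> hm; rewrite sextic_chart.
set p3 := (X in _ + X * 'X_1 * _ + _ + _); set p4 := (X in _ + X * 'X_0 ^+ 4 + _).
have [m0 m1] : (m 0%R < 4 /\ m 1%R < 4)%N by lia.
(* For m 0 < 2 the factor s^2 excludes m; otherwise m 1 = 0 and the factor t does. *)
have h3 : (p3 * 'X_1 * 'X_0 ^+ 2)@_m = 0.
  have [m2 | m2] := leqP 2 (m 0%R); last exact: mcoeff_mulXn.
  by rewrite mulrAC (@mcoeff_mulXn _ _ _ 1) //; lia.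
rewrite !mcoeffD h3 (mcoeff_mulXn p4) // (@mcoeff_mulXn _ _ 1 4) // !addr0.
have -> : 36%:R * (l%:MP ^+ 3 - 1) ^+ 2 = (36%:R * (l ^+ 3 - 1) ^+ 2)%:MP :> {mpoly K[2]} by ring.
have -> : 4%:R * (l%:MP ^+ 3 - 1) = (4%:R * (l ^+ 3 - 1))%:MP :> {mpoly K[2]} by ring.
by rewrite !mpolyXn !mcoeffCM !mcoeffX.
Qed.

Lemma cusp_row_ordinary_cusp r u (u3 : u ^+ 3 = 1) :
  ordinary_cusp (dual_sextic l) (proj_point (cusp_row_neq0 r u3)).
Proof.
have l1 : l ^+ 3 - 1 != 0 by rewrite subr_eq0.
have n36 : 36%:R * (l ^+ 3 - 1) ^+ 2 != 0 by rewrite mulf_neq0 ?expf_neq0 ?pnatr_eq0.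
have n4 : 4%:R * (l ^+ 3 - 1) != 0 by rewrite mulf_neq0 ?pnatr_eq0.
have neU (m : 'X_{1..2}) : (m 1%R < 3)%N -> (U_(1%R) *+ 3)%MM == m = false.
  by move=> m1; apply/negP => /eqP em; rewrite -em mulmnE mnm1E in m1.
exists (cusp_frame r u); rewrite /= local_equation_cusp //; split.
- exact: cusp_frame_unit.
- by rewrite rowK /= cusp_rowE.
- move=> m; rewrite mdeg2 => m2; rewrite mcoeff_sextic_chart ?m2 // neU; last by lia.
  by rewrite mulr0 addr0 mulf_eq0 (negPf n36) [m == _]eq_sym; case: (_ == m);
    rewrite ?oner_eq0 ?eqxx.
rewrite mcoeff_sextic_chart ?mulmnE ?mnm1E //= eqxx mulr1.
have -> : ((U_(0%R) *+ 2 : 'X_{1..2}) == U_(1%R) *+ 3)%MM = false.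
  by apply/negP => /eqP e; have := mulmnE U_(0%R) 2 (0 : 'I_2); rewrite e mulmnE !mnm1E.
by rewrite mulr0 add0r.
Qed.

Lemma cuspsP p : cusps (dual_curve (hesse_cubic l)) p <->
  exists r u, u ^+ 3 = 1 /\ val p = <[cusp_row r u]>%VS.
Proof.
split; first exact: cusps_sub.
move=> [r [u [u3 pE]]]; exists (dual_sextic l); first exact: dual_sextic_equation.
by have -> : p = proj_point (cusp_row_neq0 r u3); [apply: val_inj | apply: cusp_row_ordinary_cusp].
Qed.
End Cusps.

Local Open Scope classical_set_scope.
Local Open Scope card_scope.

(** * Conics through six cusps *)

Lemma passes_point_inj p p' : (forall L, passes L p = passes L p') -> p = p'.
Proof.
case: p p' => [r k] [r' k'] h.
have := h (inl r); rewrite /= eqxx => /esym/negbFE/eqP er; move: h; rewrite {}er => h.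
suff [i [j ij]] : exists i j, missed i j r = k.
  by have := h (inr (i, j)); rewrite /= ij eqxx => /esym/negbFE/eqP ->.
move: r {h}; elim/tritP; [by exists k, 0 | by exists 0, k | exists (- k), 0].
by rewrite /missed /= addr0 opprK.
Qed.

Lemma card_image_count (I : eqType) U (s : seq I) (a : pred I) (f : I -> U) :
  uniq s -> (forall i, i \in s) -> injective f ->
  f @` [set i | a i] #= `I_(count a s).
Proof.
move=> us hs injf.
have -> : f @` [set i | a i] = f @` [set` filter a s].
  by congr (f @` _); apply/seteqP; split=> i /=; rewrite mem_filter hs andbT.
rewrite (card_eql (inj_card_eq (in2W injf))) -size_filter.
have [-> | [x0 _]] : filter a s = [::] \/ exists x : I, True.
  by case: (filter a s) => [|x]; [left | right; exists x].
  by rewrite /= set_nil II0.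
have -> : [set` filter a s] = nth x0 (filter a s) @` `I_(size (filter a s)).
  apply/seteqP; split=> [i /= | _ [n /= n_lt <-]]; last exact: mem_nth.
  by move=> /(nthP x0)[n n_lt <-]; exists n.
apply: inj_card_eq => n m; rewrite !inE => n_lt m_lt /eqP.
by rewrite nth_uniq ?filter_uniq // => /eqP.
Qed.

(** * Quadratic forms in three variables *)

Section QuadraticForms.
Variable K : fieldType.
Implicit Types (A B : 'I_3 -> K).

Definition quadric A B : {mpoly K[3]} :=
  A 0 *: 'X_0 ^+ 2 + A 1 *: 'X_1 ^+ 2 + A ord_max *: 'X_ord_max ^+ 2
  + (B 0 *: ('X_1 * 'X_ord_max) + B 1 *: ('X_ord_max * 'X_0) + B ord_max *: ('X_0 * 'X_1)).

Lemma meval_quadric A B (v : 'rV[K]_3) : (quadric A B).@[v 0] =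
  A 0 * v 0 0 ^+ 2 + A 1 * v 0 1 ^+ 2 + A ord_max * v 0 ord_max ^+ 2
  + (B 0 * (v 0 1 * v 0 ord_max) + B 1 * (v 0 ord_max * v 0 0)
     + B ord_max * (v 0 0 * v 0 1)).
Proof. by rewrite !(mevalD, mevalZ, mevalM, mevalXU, expr2). Qed.

Lemma mnm3_eq (m m' : 'X_{1..3}) :
  (m == m') = [&& m 0%R == m' 0%R, m 1%R == m' 1%R & m ord_max == m' ord_max].
Proof.
apply/eqP/and3P => [-> // | [/eqP h0 /eqP h1 /eqP h2]].
by apply/mnmP; elim/tritP.
Qed.

Lemma quadric_homog A B : quadric A B \is 2.-homog.
Proof.
by rewrite /quadric !expr2 -!mpolyXD !rpredD // rpredZ // dhomogX /= mdegD !mdeg1.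
Qed.

Lemma homog2_quadric (Q : {mpoly K[3]}) : Q \is 2.-homog ->
  exists A B, Q = quadric A B.
Proof.
move=> hQ; exists (fun r => Q@_(U_(r) + U_(r))),
  (fun r => Q@_(U_(r + 1)%R + U_(r - 1)%R)%MM).
apply/mpolyP => m; have [m2 | m2] := eqVneq (mdeg m) 2%N; last first.
  by rewrite (dhomog_nemf_coeff hQ) // (dhomog_nemf_coeff (quadric_homog _ _)).
rewrite /quadric !expr2 -!mpolyXD !mcoeffD !mcoeffZ !mcoeffX !ord3E.
have {}m2 : (m 0%R + m 1%R + m ord_max = 2)%N.
  apply: etrans m2; rewrite mdegE !big_ord_recl big_ord0 addn0 addnA.
  by congr (m _ + m _ + m _)%N; apply: val_inj.
have [f Qf] : exists f, forall m', Q@_m' = f m' by exists (fun m' => Q@_m').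
rewrite !{}Qf !mnm3_eq !mnmDE !mnm1E /=.
have : [|| [&& m 0%R == 2, m 1%R == 0 & m ord_max == 0],
  [&& m 0%R == 0, m 1%R == 2 & m ord_max == 0], [&& m 0%R == 0, m 1%R == 0 & m ord_max == 2],
  [&& m 0%R == 0, m 1%R == 1 & m ord_max == 1], [&& m 0%R == 1, m 1%R == 0 & m ord_max == 1]
  | [&& m 0%R == 1, m 1%R == 1 & m ord_max == 0]]%N.
  move: m2; case: (m 0%R) => [|[|[|?]]]; case: (m 1%R) => [|[|[|?]]] //;
    by case: (m ord_max) => [|[|[|?]]].
do ?[case/orP]; case/and3P=> /eqP e0 /eqP e1 /eqP e2.
all: rewrite e0 e1 e2 /= ?(mulr0, mulr1) ?(addr0, add0r).
all: by congr (f _); apply/eqP; rewrite mnm3_eq !mnmDE !mnm1E ?e0 ?e1 ?e2.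
Qed.
End QuadraticForms.

(** * The twelve conics and their incidences *)

Section Configuration.
Variables (K : numClosedFieldType) (l w : K).
Hypotheses (l_cube : l ^+ 3 != 1) (w_root : w ^+ 2 + w + 1 = 0).
Implicit Types (A B : 'I_3 -> K).

Let P9 : set (proj_plane K) := cusps (dual_curve (hesse_cubic l)).

Definition quadric_D A B r := A r * l ^+ 2 + B r.
Definition quadric_E A B r := A r + l * B r.

(** Terms are grouped by powers of u modulo u^3 = 1: each square then shares its power with one
    mixed term. *)
Lemma quadric_cusp A B r u : u ^+ 3 = 1 ->
  (quadric A B).@[cusp_row l r u 0] = row_value (quadric_D A B) (quadric_E A B) r u.
Proof.
move=> u3; rewrite meval_quadric !row3E /row_value /quadric_D /quadric_E.
by move: r; elim/tritP; rewrite !ord3E /=; ring: u3.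
Qed.

Definition cusp_point (i : 'I_3 * 'I_3) : proj_plane K :=
  proj_point (cusp_row_neq0 l i.1 (w_exp_cube w_root i.2)).

Lemma quadric_cusp_point A B i : zero_locus (quadric A B) (cusp_point i) <->
  row_value (quadric_D A B) (quadric_E A B) i.1 (w ^+ i.2) = 0.
Proof.
rewrite -quadric_cusp ?w_exp_cube //; split=> [|h v /vlineP[k ->]].
  by apply; apply: memv_line.
suff -> : (quadric A B).@[(k *: cusp_row l i.1 (w ^+ i.2)) 0]
    = k ^+ 2 * (quadric A B).@[cusp_row l i.1 (w ^+ i.2) 0] by rewrite h mulr0.
by rewrite !meval_quadric !mxE; ring.
Qed.

Lemma cube_root_exp u : u ^+ 3 = 1 -> exists k : 'I_3, u = w ^+ k.
Proof.
move=> u3; have : (u - 1) * (u - w) * (u - w ^+ 2) = 0.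
  have w3 := w_cube w_root.
  transitivity (u ^+ 3 - w ^+ 3 - (u - w) * (u * (w ^+ 2 + w + 1))); first by ring.
  by rewrite u3 w3 w_root mulr0 mulr0 !subrr.
move/eqP; rewrite !mulf_eq0 !subr_eq0 -orbA => /or3P[] /eqP ->.
- by exists 0.
- by exists 1.
by exists ord_max.
Qed.

Lemma cuspsE : P9 = cusp_point @` [set i | true].
Proof.
apply/seteqP; split=> [p /(cuspsP l_cube)[r [u [u3 pE]]] | _ [[r k] _ <-]].
  have [k uE] := cube_root_exp u3; exists (r, k) => //.
  by apply: val_inj; rewrite pE uE.
by apply/(cuspsP l_cube); exists r, (w ^+ k); rewrite w_exp_cube.
Qed.

(* Up to the factor l^3 - 1, the inverse of (A, B) |-> (D, E). *)
Definition special_A L r := l * conic_D w L r - conic_E w L r.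
Definition special_B L r := l ^+ 2 * conic_E w L r - conic_D w L r.
Definition special_quadric L := quadric (special_A L) (special_B L).
Definition special_conic L := zero_locus (special_quadric L).

Lemma special_conic_cusp L i : special_conic L (cusp_point i) <-> passes L i.
Proof.
apply: iff_trans (quadric_cusp_point _ _ _) _; case: i => r k.
rewrite -(conic_zeros w_root) /=.
have l1 : l ^+ 3 - 1 != 0 by rewrite subr_eq0.
set v := row_value _ _ _ _; set v' := row_value _ _ _ _.
have -> : v = (l ^+ 3 - 1) * v'.
  rewrite /v /v' /row_value /quadric_D /quadric_E /special_A /special_B.
  by rewrite [conic_D]lock [conic_E]lock; ring.
by split=> [/eqP|/eqP ->]; rewrite ?mulr0 // mulf_eq0 (negPf l1).
Qed.

(** Equal points lie on the same special conics, and the incidence table separates the indices. *)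
Lemma cusp_point_inj : injective cusp_point.
Proof.
move=> i j ij; apply: passes_point_inj => L.
by apply/idP/idP => /special_conic_cusp h; apply/special_conic_cusp; rewrite ?ij // -ij.
Qed.

Lemma special_conic_inj : injective special_conic.
Proof.
move=> L L' LL'; apply: passes_inj => i.
by apply/idP/idP => /special_conic_cusp h; apply/special_conic_cusp; rewrite ?LL' // -LL'.
Qed.

(** A zero form would vanish at all nine cusps, whereas this one vanishes at six. *)
Lemma special_conic_conic L : conic (special_conic L).
Proof.
exists (special_quadric L); split=> //; last exact: quadric_homog.
apply/eqP => Q0; have all_pass i : passes L i.
  by apply/special_conic_cusp => v _; rewrite Q0 meval0.
by have := count_passes_conic L; rewrite (eq_count (a2 := predT)).
Qed.

Let C12 := conics_through_at_least 6 P9.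

Lemma conic_cusps_card (Z : set (proj_plane K)) (a : pred ('I_3 * 'I_3)) :
  (forall i, Z (cusp_point i) <-> a i) ->
  P9 `&` Z #= `I_(count a cusp_indices).
Proof.
move=> Za; have -> : P9 `&` Z = cusp_point @` [set i | a i].
  rewrite cuspsE; apply/seteqP; split=> [_ [[i _ <-]] /Za ai | _ [i /= ai <-]].
    by exists i.
  by split; [exists i | apply/Za].
by apply: card_image_count => //; [exact: mem_cusp_indices | exact: cusp_point_inj].
Qed.

Lemma conics_through_sixE : C12 = special_conic @` [set L | true].
Proof.
apply/seteqP; split=> [Z [[Q [Q0 hQ ZQ]]] | _ [L _ <-]]; last first.
  split; first exact: special_conic_conic.
  rewrite setIC.
  have := conic_cusps_card (special_conic_cusp L); rewrite count_passes_conic => h.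
  by rewrite (card_le_eqr h).
have [A [B QE]] := homog2_quadric hQ.
pose a (p : 'I_3 * 'I_3) := row_value (quadric_D A B) (quadric_E A B) p.1 (w ^+ p.2) == 0.
have Za i : Z (cusp_point i) <-> a i.
  by rewrite ZQ QE; apply: iff_trans (quadric_cusp_point _ _ _) _; split=> /eqP.
rewrite setIC (card_le_eqr (conic_cusps_card Za)) card_le_II => a6.
have l1 : l ^+ 3 - 1 != 0 by rewrite subr_eq0.
have AE r : (l ^+ 3 - 1) * A r = l * quadric_D A B r - quadric_E A B r.
  by rewrite /quadric_D /quadric_E; ring.
have BE r : (l ^+ 3 - 1) * B r = l ^+ 2 * quadric_E A B r - quadric_D A B r.
  by rewrite /quadric_D /quadric_E; ring.
have [|L [c [c0 hc]]] := sextuple_conic w_root a6.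
  (* If all D r and E r vanished, so would A and B, since l^3 != 1, and Q would be zero. *)
  apply/existsP; apply: contraNT Q0 => /existsPn DE0; rewrite QE.
  have DE r : quadric_D A B r = 0 /\ quadric_E A B r = 0.
    by have := DE0 r; rewrite negb_or !negbK => /andP[/eqP ? /eqP ?].
  have AB r : A r = 0 /\ B r = 0.
    by split; apply: (mulfI l1); rewrite ?AE ?BE !(DE r).1 !(DE r).2 !mulr0 subrr.
  by rewrite /quadric !(AB _).1 !(AB _).2 !scale0r !addr0 eqxx.
exists L => //; rewrite ZQ; pose c' := c / (l ^+ 3 - 1).
have c'0 : c' != 0 by rewrite mulf_neq0 ?invr_eq0.
have AE' r : A r = c' * special_A L r.
  by apply: (mulfI l1); rewrite AE (hc r).1 (hc r).2 /special_A /c'; field.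
have BE' r : B r = c' * special_B L r.
  by apply: (mulfI l1); rewrite BE (hc r).1 (hc r).2 /special_B /c'; field.
have -> : Q = c' *: special_quadric L.
  by rewrite QE /special_quadric /quadric !AE' !BE' !scalerDr !scalerA.
apply/seteqP; split=> p hp v vp; first by rewrite mevalZ hp ?mulr0.
by have /eqP := hp v vp; rewrite mevalZ mulf_eq0 (negPf c'0) => /eqP.
Qed.

Lemma cusps_conics_configuration :
  [/\ C12 #= `I_12,
      forall Z, C12 Z -> P9 `&` Z #= `I_6,
      forall p, P9 p -> [set Z | C12 Z /\ Z p] #= `I_8
    & configuration P9 C12 (fun p Z => Z p) 9 8 12 6].
Proof.
have card_C : C12 #= `I_12.
  rewrite conics_through_sixE; apply: (@card_image_count _ _ conic_indices) => //.
    exact: mem_conic_indices.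
  exact: special_conic_inj.
have card_P : P9 #= `I_9.
  rewrite cuspsE; apply: (@card_image_count _ _ cusp_indices) => //.
    exact: mem_cusp_indices.
  exact: cusp_point_inj.
have six Z : C12 Z -> P9 `&` Z #= `I_6.
  rewrite conics_through_sixE => -[L _ <-].
  by rewrite -(count_passes_conic L); apply/conic_cusps_card/special_conic_cusp.
have eight p : P9 p -> [set Z | C12 Z /\ Z p] #= `I_8.
  rewrite cuspsE => -[i _ <-]; rewrite -(count_passes_cusp i).
  have -> : [set Z | C12 Z /\ Z (cusp_point i)] = special_conic @` [set L | passes L i].
    rewrite conics_through_sixE; apply/seteqP; split=> [_ [[L _ <-]] | _ [L /= Li <-]].
      by move/special_conic_cusp; exists L.
    by split; [exists L | apply/special_conic_cusp].
  apply: card_image_count => //; [exact: mem_conic_indices | exact: special_conic_inj].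
by split.
Qed.
End Configuration.

Theorem theorem1 (R : realType) :
  exists S : set R[i], finite_set S /\
  forall lambda : R[i], ~ S lambda ->
  let P9 : set (proj_plane R[i]) := cusps (dual_curve (hesse_cubic lambda)) in
  let C12 : set (set (proj_plane R[i])) := conics_through_at_least 6 P9 in
  [/\ C12 #= `I_12,
      forall Z, C12 Z -> P9 `&` Z #= `I_6,
      forall p, P9 p -> [set Z | C12 Z /\ Z p] #= `I_8
    & configuration P9 C12 (fun p Z => Z p) 9 8 12 6].
Proof.
pose w : R[i] := (-1 + sqrtC (- 3%:R)) / 2%:R.
have w_root : w ^+ 2 + w + 1 = 0.
  have n2 : (2%:R : R[i]) != 0 by rewrite pnatr_eq0.
  have s3 := sqrtCK (- 3%:R : R[i]).
  by rewrite /w; field: s3.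
(* The excluded parameters are those for which the cubic is singular. *)
exists [set x | x ^+ 3 = 1]; split.
  apply: sub_finite_set (finite_seq [seq w ^+ (i : 'I_3) | i <- trits]) => x x3.
  have [k xk] := cube_root_exp w_root x3.
  by rewrite /= xk !inE; move: k {xk}; elim/tritP; rewrite eqxx ?orbT.
by move=> l l3; apply: cusps_conics_configuration w_root; apply/eqP.
Qed.
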